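(* For all $0\le n<i\le N$ and $x\in\mathbb{R}$, the overshoot expectation $E_{t_n,t_i}(x)=E\big(X_{t_n,t_i}(x)\mid \tau_{t_n}(x)=t_i\big)$ satisfies $$E_{t_n,t_i}(x)=\frac{\widehat{e}_{t_n,t_i}(x)-(1-p_{t_n,t_i}(x))\,e_{t_n,t_i}(x)}{p_{t_n,t_i}(x)},$$ where $$p_{t_n,t_i}(x)=\frac{F(-\widehat{\mathbf{B}}_{t_n,t_i}(x),\Sigma_{t_n,t_i})-F(-\mathbf{B}_{t_n,t_i}(x),\Sigma_{t_n,t_i})}{F(-\widehat{\mathbf{B}}_{t_n,t_i}(x),\Sigma_{t_n,t_i})},$$ $$e_{t_n,t_i}(x)=\mu_{t_n,t_i}(x)+\frac{\sigma_{t_n,t_i}\sum_{l=n+1}^{i}\mathrm{cov}(Z_{t_n,t_i}(x),Z_{t_n,t_l}(x))\,\phi(\beta_{t_n,t_l}(x))\,F(-\mathbf{A}_{t_n,t_i.t_l}(x),\mathbf{M}_{t_i,t_n.t_l}(x))}{F(-\mathbf{B}_{t_n,t_i}(x),\Sigma_{t_n,t_i})},$$ $$\widehat{e}_{t_n,t_i}(x)=\mu_{t_n,t_i}(x)+\frac{\sigma_{t_n,t_i}\sum_{l=n+1}^{i}\mathrm{cov}(Z_{t_n,t_i}(x),Z_{t_n,t_l}(x))\,\phi(\widehat\beta_{t_n,t_l}(x))\,F(-\widehat{\mathbf{A}}_{t_n,t_i.t_l}(x),\mathbf{M}_{t_i,t_n.t_l}(x))}{F(-\widehat{\mathbf{B}}_{t_n,t_i}(x),\Sigma_{t_n,t_i})},$$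 and, for $i=N$ (where $p_{t_n,t_N}(x)=1$), the product $(1-p_{t_n,t_i}(x))\,e_{t_n,t_i}(x)$ is read as $0$.
   Context: Model. A single item must be purchased within a finite horizon $[0,T]$. Decisions are made on the grid $t_n = n\cdot dt$, $0\le n\le N$, with $dt>0$ and $N=T/dt$. The item's price follows the AR(1) process $X_t = \theta K\,dt + (1-K\,dt)X_{t-dt} + \sigma\varepsilon_t$, where $\theta\in\mathbb{R}$, $\sigma>0$, $|1-K\,dt|<1$, and the $\varepsilon_{t_1},\varepsilon_{t_2},\dots$ are i.i.d. $N(0,dt)$. For $t_n<t_i$, $X_{t_n,t_i}(x)$ denotes the random price $X_{t_i}$ conditioned on $X_{t_n}=x$, i.e. $$X_{t_n,t_i}(x)=\theta+(x-\theta)(1-dt\,K)^{i-n}+\sigma\sum_{j=0}^{i-n-1}(1-dt\,K)^j\varepsilon_{t_{i-j}}.$$ Holding the item from $t_n$ to $t_N$ costs $dt\sum_{i=n}^{N-1}h_{t_i}$, where the per-unit-time holding costs $h_{t_0},\dots,h_{t_{N-1}}$ are real numbers that are weakly decreasing in time. Value function. $V(x,t_N)=x$, and for $0\le n<N$, $V(x,t_n)=\min\{V^C(x,t_n),\, x+dt\sum_{i=n}^{N-1}h_{t_i}\}$ with $V^C(x,t_n)=E[V(X_{t_n,t_{n+1}}(x),t_{n+1})]$. Threshold. For $0\le n\le N-1$, $b(t_n)$ is the (single) real number with $V^C(b(t_n),t_n)=b(t_n)+dt\sum_{i=n}^{N-1}h_{t_i}$; by convention $b(t_N)=\infty$. Crossing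 time. $\tau_{t_n}(x)=\inf\{t_i>t_n : X_{t_n,t_i}(x)\le b(t_i)\}$. Standardization. $X_{t_n,t_i}(x)$ is normal with mean $\mu_{t_n,t_i}(x)=\theta+(x-\theta)(1-dt\,K)^{i-n}$ and variance $\sigma^2_{t_n,t_i}=dt\,\sigma^2\frac{1-(1-dt K)^{2(i-n)}}{1-(1-dt K)^2}$. Put $Z_{t_n,t_i}(x)=(X_{t_n,t_i}(x)-\mu_{t_n,t_i}(x))/\sigma_{t_n,t_i}$. $\Sigma_{t_n,t_i}$ is the covariance matrix of $(Z_{t_n,t_{n+1}}(x),\dots,Z_{t_n,t_i}(x))$, whose entries are, for $n+1\le l\le k\le i$, $$\mathrm{cov}(Z_{t_n,t_l}(x),Z_{t_n,t_k}(x))=\frac{dt\,\sigma^2(1-dt K)^{k-l}}{\sigma_{t_n,t_l}\sigma_{t_n,t_k}}\cdot\frac{1-(1-dt K)^{2(l-n)}}{1-(1-dt K)^2}.$$ Write $c_{l,j}=\mathrm{cov}(Z_{t_n,t_l}(x),Z_{t_n,t_j}(x))$. Vectors and matrices. For fixed $n<i$ and $n+1\le l\le i$: $\beta_{t_n,t_l}(x)=(b(t_l)-\mu_{t_n,t_l}(x))/\sigma_{t_n,t_l}$; $\widehat\beta_{t_n,t_l}(x)=\beta_{t_n,t_l}(x)$ if $l\le i-1$ and $\widehat\beta_{t_n,t_i}(x)=-\infty$; $\mathbf{B}_{t_n,t_i}(x)$ and $\widehat{\mathbf{B}}_{t_n,t_i}(x)$ are the vectors with entries $\beta_{t_n,t_l}(x)$,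 respectively $\widehat\beta_{t_n,t_l}(x)$, $l=n+1,\dots,i$. For $n+1\le j\le i$, $l\ne j$: $$\alpha_{t_n,t_l.t_j}(x)=\frac{\beta_{t_n,t_l}(x)-c_{l,j}\,\beta_{t_n,t_j}(x)}{\sqrt{1-c_{l,j}^2}},$$ and $\widehat\alpha_{t_n,t_l.t_j}(x)=\alpha_{t_n,t_l.t_j}(x)$ if $l\le i-1$, while $\widehat\alpha_{t_n,t_i.t_j}(x)=-\infty$. $\mathbf{A}_{t_n,t_i.t_j}(x)$ and $\widehat{\mathbf{A}}_{t_n,t_i.t_j}(x)$ are the $(i-n-1)$-vectors with entries $\alpha_{t_n,t_l.t_j}(x)$, respectively $\widehat\alpha_{t_n,t_l.t_j}(x)$, for $l\in\{n+1,\dots,i\}\setminus\{j\}$. $\mathbf{M}_{t_i,t_n.t_j}(x)$ is the $(i-n-1)\times(i-n-1)$ first-order partial correlation matrix of $Z_{t_n,t_{n+1}}(x),\dots,Z_{t_n,t_i}(x)$ with controlling variable $Z_{t_n,t_j}(x)$ removed, with entries, for $l,m\in\{n+1,\dots,i\}\setminus\{j\}$, $$\rho_{t_l,t_m.t_j}(x)=\frac{c_{l,m}-c_{l,j}\,c_{m,j}}{\sqrt{1-c_{l,j}^2}\,\sqrt{1-c_{m,j}^2}}.$$ Functions. $\phi$ is the standard normal density, with $\phi(\pm\infty)=0$ (and a summand containing the factor $\phi(\pm\infty)$ is $0$). $F(\mathbf{a},\Sigma)$ is the cumulative distribution function, at $\mathbf{a}$, of a standard multivariate normal vector (zero means, unit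 variances) with covariance matrix $\Sigma$, extended to entries $\pm\infty$ in the usual way; in dimension $0$ it equals $1$. *)

(* Defs.v *)
From HB Require Import structures.
From mathcomp Require Import all_boot all_order all_algebra.
From mathcomp Require Import all_classical all_reals all_analysis.
From mathcomp Require Import ring.

Set Implicit Arguments.
Unset Strict Implicit.
Unset Printing Implicit Defensive.

Import Order.TTheory GRing.Theory Num.Theory.
Import numFieldNormedType.Exports.

Local Open Scope classical_set_scope.
Local Open Scope ring_scope.

Section probability_notions.
Context d (Omega : measurableType d) (R : realType) (P : probability Omega R).

(* Product rule over every finite subfamily of the indices in I. *)
Definition mutually_independent (I : pred nat) (eps : nat -> {RV P >-> R}) :=
  forall (J : seq nat) (A : nat -> set R),
    uniq J -> {subset J <= I} -> (forall j, measurable (A j)) ->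
    (P (\big[setI/setT]_(j <- J) (eps j @^-1` A j))
     = \prod_(j <- J) P (eps j @^-1` A j))%E.

(* E(Y | A) for an event A of positive probability. *)
Definition cond_expectation (Y : Omega -> R) (A : set Omega) : R :=
  fine (\int[P]_(w in A) (Y w)%:E)%E / fine (P A).

End probability_notions.

Section multivariate_normal.
Context {R : realType}.

(* The integral over R^k, as an iterated Lebesgue integral; for nonnegative
   measurable functions the order of integration is immaterial. *)
Fixpoint integral_rV (k : nat) : ('rV[R]_k -> \bar R) -> \bar R :=
  match k return ('rV[R]_k -> \bar R) -> \bar R with
  | 0%N => fun f => f 0
  | k'.+1 => fun f =>
      (\int[lebesgue_measure]_t
         integral_rV (fun v : 'rV[R]_k' => f (row_mx (t%:M : 'M[R]_1) v)))%E
  end.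

(* Density of N(0, S) on R^k, for S positive definite (which holds for the
   matrices Sigma and M below, so no singular case is needed). *)
Definition mvn_pdf (k : nat) (S : 'M[R]_k) (z : 'rV[R]_k) : R :=
  expR (- (z *m invmx S *m z^T) 0 0 / 2) / Num.sqrt ((2 * pi) ^+ k * \det S).

(* F(a, S) = P(Z_l <= a_l for all l) with Z ~ N(0, S); the entries of a may be
   infinite, and mvn_cdf is 1 when k = 0. *)
Definition mvn_cdf (k : nat) (a : 'rV[\bar R]_k) (S : 'M[R]_k) : R :=
  fine (integral_rV (fun z : 'rV[R]_k =>
    if [forall l, ((z ord0 l)%:E <= a ord0 l)%E] then (mvn_pdf S z)%:E else 0%E)).

(* Standard normal density, equal to 0 at -oo and +oo. *)
Definition std_normal_pdf (y : \bar R) : R :=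
  if y is r%:E then normal_pdf 0 1 r else 0.

Definition opp_vec (k : nat) (a : 'rV[\bar R]_k) : 'rV[\bar R]_k :=
  \row_l (- a ord0 l)%E.

End multivariate_normal.

(* Throughout, the time t_n = n * dt is represented by its index n. *)
Section model.
Context d (Omega : measurableType d) (R : realType) (P : probability Omega R).
Context (dt K theta sigma : R) (eps : nat -> {RV P >-> R}).
Context (N : nat) (h : nat -> R).

Definition grid_time (n : nat) : R := n%:R * dt.

(* X_{t_n,t_i}(x) for n <= i: the price at t_i when the price at t_n is x. *)
Definition price (n i : nat) (x : R) (w : Omega) : R :=
  theta + (x - theta) * (1 - dt * K) ^+ (i - n)
  + sigma * \sum_(j < i - n) (1 - dt * K) ^+ j * eps (i - j)%N w.

Lemma price_start (n : nat) (x : R) (w : Omega) : price n n x w = x.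
Proof. by rewrite /price subnn big_ord0; ring. Qed.

Lemma price_AR1 (n i : nat) (x : R) (w : Omega) : (n <= i)%N ->
  price n i.+1 x w
  = theta * K * dt + (1 - K * dt) * price n i x w + sigma * eps i.+1 w.
Proof.
move=> ni; rewrite /price subSn// big_ord_recl subn0 /= expr0 exprS.
under eq_bigr do rewrite /bump /= add1n subSS exprS -mulrA.
by rewrite -mulr_sumr; ring.
Qed.

(* Cost of holding the item from t_n to t_N. *)
Definition holding_cost (n : nat) : R := dt * \sum_(n <= i < N) h i.

(* V(x, t_(N - m)), by recursion on the number m of remaining periods. *)
Fixpoint value_rem (m : nat) (x : R) : R :=
  if m is m'.+1 then
    Num.min
      (fine 'E_P[fun w => value_rem m' (price (N - m) (N - m).+1 x w)])
      (x + holding_cost (N - m))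
  else x.

Definition value (n : nat) (x : R) : R := value_rem (N - n) x.

(* V^C(x, t_n) *)
Definition cont_value (n : nat) (x : R) : R :=
  fine 'E_P[fun w => value n.+1 (price n n.+1 x w)].

Lemma value_horizon (x : R) : value N x = x.
Proof. by rewrite /value subnn. Qed.

Lemma value_min (n : nat) (x : R) : (n < N)%N ->
  value n x = Num.min (cont_value n x) (x + holding_cost n).
Proof.
move=> nN; rewrite /value -subnSK//= subnSK// subKn; last exact: ltnW.
by [].
Qed.

(* b is the family of thresholds b(t_0), ..., b(t_N). *)
Definition is_threshold (b : nat -> \bar R) :=
  (forall n, (n < N)%N ->
     exists2 r, b n = r%:E & cont_value n r = r + holding_cost n)
  /\ b N = +oo%E.

Context (b : nat -> \bar R).

(* tau_{t_n}(x) *)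
Definition crossing_time (n : nat) (x : R) (w : Omega) : \bar R :=
  ereal_inf [set (grid_time i)%:E | i in
    [set i : nat | (n < i <= N)%N /\ ((price n i x w)%:E <= b i)%E]].

(* E_{t_n,t_i}(x) *)
Definition overshoot (n i : nat) (x : R) : R :=
  cond_expectation P (price n i x)
    [set w | crossing_time n x w = (grid_time i)%:E].

(* mu_{t_n,t_i}(x) *)
Definition price_mean (n i : nat) (x : R) : R :=
  theta + (x - theta) * (1 - dt * K) ^+ (i - n).

(* sigma_{t_n,t_i} *)
Definition price_sd (n i : nat) : R :=
  Num.sqrt (dt * sigma ^+ 2 * ((1 - (1 - dt * K) ^+ (2 * (i - n)))
                               / (1 - (1 - dt * K) ^+ 2))).

(* Z_{t_n,t_i}(x) *)
Definition std_price (n i : nat) (x : R) (w : Omega) : R :=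
  (price n i x w - price_mean n i x) / price_sd n i.

(* c_{l,k} = cov(Z_{t_n,t_l}(x), Z_{t_n,t_k}(x)) *)
Definition std_cov (n : nat) (x : R) (l k : nat) : R :=
  fine (covariance P (std_price n l x) (std_price n k x)).

(* beta_{t_n,t_l}(x) *)
Definition beta (n : nat) (x : R) (l : nat) : \bar R :=
  ((b l - (price_mean n l x)%:E) * ((price_sd n l)^-1)%:E)%E.

Definition beta_hat (n i : nat) (x : R) (l : nat) : \bar R :=
  if (l < i)%N then beta n x l else -oo%E.

(* alpha_{t_n,t_l.t_j}(x) *)
Definition alpha (n : nat) (x : R) (l j : nat) : \bar R :=
  ((beta n x l - (std_cov n x l j)%:E * beta n x j)
   * ((Num.sqrt (1 - std_cov n x l j ^+ 2))^-1)%:E)%E.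

Definition alpha_hat (n i : nat) (x : R) (l j : nat) : \bar R :=
  if (l < i)%N then alpha n x l j else -oo%E.

(* rho_{t_l,t_m.t_j}(x) *)
Definition partial_corr (n : nat) (x : R) (l m j : nat) : R :=
  (std_cov n x l m - std_cov n x l j * std_cov n x m j)
  / (Num.sqrt (1 - std_cov n x l j ^+ 2) * Num.sqrt (1 - std_cov n x m j ^+ 2)).

(* Vectors indexed by l = n + 1, ..., i are indexed by k : 'I_(i - n), with
   l = n + 1 + k. Removing the index j leaves the positions [lift j k], with
   k : 'I_(i - n).-1, in increasing order. *)
Definition idx (n k : nat) : nat := (n.+1 + k)%N.

(* Sigma_{t_n,t_i} *)
Definition cov_mx (n i : nat) (x : R) : 'M[R]_(i - n) :=
  \matrix_(k, m) std_cov n x (idx n k) (idx n m).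

(* B_{t_n,t_i}(x) *)
Definition B_vec (n i : nat) (x : R) : 'rV[\bar R]_(i - n) :=
  \row_k beta n x (idx n k).

Definition B_hat_vec (n i : nat) (x : R) : 'rV[\bar R]_(i - n) :=
  \row_k beta_hat n i x (idx n k).

(* A_{t_n,t_i.t_j}(x) *)
Definition A_vec (n i : nat) (x : R) (j : 'I_(i - n))
    : 'rV[\bar R]_((i - n).-1) :=
  \row_k alpha n x (idx n (lift j k)) (idx n j).

Definition A_hat_vec (n i : nat) (x : R) (j : 'I_(i - n))
    : 'rV[\bar R]_((i - n).-1) :=
  \row_k alpha_hat n i x (idx n (lift j k)) (idx n j).

(* M_{t_i,t_n.t_j}(x) *)
Definition partial_corr_mx (n i : nat) (x : R) (j : 'I_(i - n))
    : 'M[R]_((i - n).-1) :=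
  \matrix_(k, m)
    partial_corr n x (idx n (lift j k)) (idx n (lift j m)) (idx n j).

(* p_{t_n,t_i}(x) *)
Definition stop_prob (n i : nat) (x : R) : R :=
  (mvn_cdf (opp_vec (B_hat_vec n i x)) (cov_mx n i x)
   - mvn_cdf (opp_vec (B_vec n i x)) (cov_mx n i x))
  / mvn_cdf (opp_vec (B_hat_vec n i x)) (cov_mx n i x).

(* e_{t_n,t_i}(x) *)
Definition trunc_mean (n i : nat) (x : R) : R :=
  price_mean n i x
  + price_sd n i
    * (\sum_(l < i - n)
         std_cov n x i (idx n l) * std_normal_pdf (beta n x (idx n l))
         * mvn_cdf (opp_vec (A_vec x l)) (partial_corr_mx x l))
    / mvn_cdf (opp_vec (B_vec n i x)) (cov_mx n i x).

Definition trunc_mean_hat (n i : nat) (x : R) : R :=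
  price_mean n i x
  + price_sd n i
    * (\sum_(l < i - n)
         std_cov n x i (idx n l) * std_normal_pdf (beta_hat n i x (idx n l))
         * mvn_cdf (opp_vec (A_hat_vec x l)) (partial_corr_mx x l))
    / mvn_cdf (opp_vec (B_hat_vec n i x)) (cov_mx n i x).

End model.

(* Main.v *)
Require Import Defs.
From HB Require Import structures.
From mathcomp Require Import all_boot all_order all_algebra.
From mathcomp Require Import all_classical all_reals all_analysis.
From mathcomp Require Import measurable_realfun ring lra.

Set Implicit Arguments.
Unset Strict Implicit.
Unset Printing Implicit Defensive.

Import Order.TTheory GRing.Theory Num.Theory.
Import numFieldNormedType.Exports.

Local Open Scope classical_set_scope.
Local Open Scope ring_scope.

(** The standardized prices at the grid times after t_n form a Gaussian vector
    Z = xi U, where xi is a vector of independent standard normal shocks and U is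
    triangular with nonzero diagonal; hence Z has density mvn_pdf S with
    S = U^T U. Since Z and -Z have the same law and hyperplanes are null,
    P(Z > B) = F(-B, S).

    The truncated first moments are given by Tallis' formula. With W = S^-1, the
    function (z W)_l mvn_pdf S z is minus the partial derivative of mvn_pdf S in
    z_l, so that integrating it over {z >= B} leaves the integral of mvn_pdf S over
    the face z_l = B_l; conditioning on Z_l = B_l, the latter is
    phi(B_l) F(-A_l, M_l). As z_i = sum_l S_il (z W)_l, this gives
    E(Z_i; Z > B) = sum_l S_il phi(B_l) F(-A_l, M_l).

    Finally {tau = t_i} is the difference of the events Z > B_hat and Z > B,
    the former imposing no condition at t_i. *)

(** * Product measures on row vectors *)

(** Every argument in dimension [k] singles out one coordinate. Measures on rows are built by
    adjoining a coordinate in front, as [integral_rV] does, but they are determined by boxes, so the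
    adjoined coordinate may sit at any position [l] ([powm_ins]). This freedom allows the l-th
    variable to be integrated first, for each [l], by a one-dimensional fundamental theorem of
    calculus. The score functions are signed, so their integrability has to be carried along for
    Fubini's theorem. All substitutions under an integral are triangular and reduce to affine
    substitutions on the line. Conditioning on one coordinate involves no conditional laws: it is a
    congruence between [S] and a block diagonal matrix, hence an identity between densities. Bounds
    are extended reals because both infinities occur: [-oo] at the last entry of the vectors with
    hats, [+oo] at the horizon. In both cases the boundary term vanishes, in agreement with the
    convention for the normal density. Vanishing denominators are settled at the very end, by
    division by 0 being 0. *)

Definition row_display : measure_display.
Proof. exact: default_measure_display. Qed.

Section measurable_row.
Context {R : realType}.

Let coor k (i : 'I_k) (z : 'rV[R]_k) : R := z ord0 i.

Let row_set0 k : g_sigma_preimage (@coor k) set0.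
Proof. exact: sigma_algebra0. Qed.

Let row_setC k A : g_sigma_preimage (@coor k) A -> g_sigma_preimage (@coor k) (~` A).
Proof. exact: sigma_algebraC. Qed.

Let row_bigcup k (F : (set 'rV[R]_k)^nat) :
  (forall i, g_sigma_preimage (@coor k) (F i)) ->
  g_sigma_preimage (@coor k) (\bigcup_i (F i)).
Proof. exact: sigma_algebra_bigcup. Qed.

HB.instance Definition _ k := @isMeasurable.Build row_display
  'rV[R]_k (g_sigma_preimage (@coor k)) (@row_set0 k) (@row_setC k) (@row_bigcup k).

Lemma measurable_coord k (i : 'I_k) :
  measurable_fun setT (fun z : 'rV[R]_k => z ord0 i).
Proof.
move=> _ Y mY; rewrite setTI; apply: sub_sigma_algebra => /=.
rewrite -bigcup_seq/=; exists i => /=; first by rewrite mem_index_enum.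
by exists Y => //; rewrite setTI.
Qed.

Lemma measurable_fun_row d (T : measurableType d) k (f : T -> 'rV[R]_k) :
  (forall i, measurable_fun setT (fun x => f x ord0 i)) -> measurable_fun setT f.
Proof.
move=> mf; suff : g_sigma_preimage (fun i => @coor k i \o f) `<=` measurable.
  by rewrite g_sigma_preimage_comp => prefS _ A mA; apply: prefS; exists A.
apply: smallest_sub; first exact: sigma_algebra_measurable.
rewrite -bigcup_seq/= => A [i _ [B mB <-]].
exact: mf.
Qed.

Definition box k (A : 'I_k -> set R) : set 'rV[R]_k :=
  [set z | forall i, A i (z ord0 i)].

Lemma measurable_box k (A : 'I_k -> set R) :
  (forall i, measurable (A i)) -> measurable (box A).
Proof.
move=> mA; have -> : box A = \big[setI/setT]_(i < k) ((fun z : 'rV[R]_k => z ord0 i) @^-1` A i).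
  rewrite -bigcap_seq; apply/seteqP; split => z /= Az i.
    by move=> _; exact: Az.
  by apply: Az; rewrite /= mem_index_enum.
apply: bigsetI_measurable => i _.
by rewrite -[X in measurable X]setTI; exact: measurable_coord.
Qed.

(** The position [l] is free so that any coordinate can be split off by Fubini's theorem. *)
Definition ins_row k (l : 'I_k.+1) (p : measurableTypeR R * 'rV[R]_k) : 'rV[R]_k.+1 :=
  \row_j if unlift l j is Some j' then p.2 ord0 j' else p.1.

Lemma ins_row_id k l (p : measurableTypeR R * 'rV[R]_k) : ins_row l p ord0 l = p.1.
Proof. by rewrite mxE unlift_none. Qed.

Lemma ins_row_lift k l (p : measurableTypeR R * 'rV[R]_k) i :
  ins_row l p ord0 (lift l i) = p.2 ord0 i.
Proof. by rewrite mxE liftK. Qed.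

Lemma row_mx_ins k (t : R) (v : 'rV[R]_k) :
  row_mx (t%:M : 'M[R]_1) v = ins_row ord0 (t, v).
Proof.
apply/rowP => j; case: (unliftP ord0 j) => [i|] ->.
- rewrite ins_row_lift (_ : lift ord0 i = rshift 1 i); last exact/val_inj.
  by rewrite row_mxEr.
- rewrite ins_row_id (_ : ord0 = lshift k (ord0 : 'I_1)); last exact/val_inj.
  by rewrite row_mxEl mxE eqxx mulr1n.
Qed.

Definition del_row k (l : 'I_k.+1) (z : 'rV[R]_k.+1) : measurableTypeR R * 'rV[R]_k :=
  (z ord0 l, \row_j z ord0 (lift l j)).

Lemma ins_rowK k (l : 'I_k.+1) : cancel (ins_row l) (@del_row k l).
Proof.
case=> t v; rewrite /del_row ins_row_id; congr pair.
by apply/rowP => j; rewrite mxE ins_row_lift.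
Qed.

Lemma measurable_ins_row k (l : 'I_k.+1) : measurable_fun setT (@ins_row k l).
Proof.
apply: measurable_fun_row => i; case: (unliftP l i) => [j|] ->.
- under eq_fun do rewrite ins_row_lift.
  exact: (measurableT_comp (measurable_coord j) measurable_snd).
- under eq_fun do rewrite ins_row_id.
  exact: measurable_fst.
Qed.

Lemma measurable_del_row k (l : 'I_k.+1) : measurable_fun setT (@del_row k l).
Proof.
apply: measurable_fun_pair; first exact: measurable_coord.
apply: measurable_fun_row => j.
by under eq_fun do rewrite /del_row/= mxE; exact: measurable_coord.
Qed.

Lemma preimage_ins_row_box k (l : 'I_k.+1) (A : 'I_k.+1 -> set R) :
  @ins_row k l @^-1` box A = A l `*` box (A \o lift l).
Proof.
apply/seteqP; split => [[t v] /= Az|[t v] /= [At Av] i].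
- split=> /= [|i]; first by have := Az l; rewrite ins_row_id.
  by have := Az (lift l i); rewrite ins_row_lift.
- by case: (unliftP l i) => [j|] ->; rewrite ?ins_row_lift ?ins_row_id//; exact: Av.
Qed.

End measurable_row.

(** * Powers of a sigma-finite measure on the line *)

Section row_product_measure.
Context {R : realType}.

Section step.
Variables (mu : {sigma_finite_measure set (measurableTypeR R) -> \bar R}) (k : nat).
Variable nu : {sigma_finite_measure set 'rV[R]_k -> \bar R}.

Definition cons_measure : set 'rV[R]_k.+1 -> \bar R :=
  pushforward (mu \x nu)%E (@ins_row R k ord0).

Let cons_measure0 : cons_measure set0 = 0%E.
Proof. by rewrite /cons_measure /pushforward preimage_set0 measure0. Qed.

Let cons_measure_ge0 A : (0 <= cons_measure A)%E.
Proof. by rewrite /cons_measure /pushforward; exact: measure_ge0. Qed.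

Let cons_measure_sigma_additive : semi_sigma_additive cons_measure.
Proof.
pose f : {mfun _ >-> _} := HB.pack (@ins_row R k ord0)
  (isMeasurableFun.Build _ _ _ _ _ (@measurable_ins_row R k ord0)).
exact: (@measure_semi_sigma_additive _ _ _ (pushforward (mu \x nu)%E f)).
Qed.

HB.instance Definition _ := isMeasure.Build _ _ _ cons_measure
  cons_measure0 cons_measure_ge0 cons_measure_sigma_additive.

Let cons_measure_sigma_finite : sigma_finite setT cons_measure.
Proof.
have /sigma_finiteP[F [FT ndF mF]] := sigma_finiteT mu.
have /sigma_finiteP[G [GT ndG mG]] := sigma_finiteT nu.
exists (fun i => @del_row R k ord0 @^-1` (F i `*` G i)).
  apply/esym; rewrite -subTset => z _.
  have [i _ Fi] : (\bigcup_i F i) (@del_row R k ord0 z).1 by rewrite -FT.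
  have [j _ Gj] : (\bigcup_i G i) (@del_row R k ord0 z).2 by rewrite -GT.
  (* Both exhaustions increase, so products with equal indices already cover the space. *)
  exists (maxn i j) => //; split.
  - by move: (_.1) Fi; exact/subsetPset/ndF/leq_maxl.
  - by move: (_.2) Gj; exact/subsetPset/ndG/leq_maxr.
move=> i; have [mFi Foo] := mF i; have [mGi Goo] := mG i; split.
  rewrite -[X in measurable X]setTI; apply: measurable_del_row => //.
  exact: measurableX.
rewrite /cons_measure /pushforward -comp_preimage.
rewrite (_ : _ \o _ = id) ?preimage_id//; last first.
  by apply/funext => p /=; rewrite ins_rowK.
by rewrite product_measure1E// lte_mul_pinfty// ge0_fin_numE.
Qed.

HB.instance Definition _ := Measure_isSigmaFinite.Build _ _ _ cons_measure
  cons_measure_sigma_finite.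

End step.

(** Dimension 0 carries the unit mass at the only row, in agreement with [integral_rV], which
    evaluates its argument there. *)
Fixpoint powm (mu : {sigma_finite_measure set (measurableTypeR R) -> \bar R}) (k : nat) :
    {sigma_finite_measure set 'rV[R]_k -> \bar R} :=
  match k return {sigma_finite_measure set 'rV[R]_k -> \bar R} with
  | 0 => \d_(0 : 'rV[R]_0)
  | k'.+1 => cons_measure mu (powm mu k')
  end.

Lemma powmS_box (mu : {sigma_finite_measure set (measurableTypeR R) -> \bar R}) k (A : 'I_k.+1 -> set R) :
  (forall i, measurable (A i)) ->
  (powm mu k.+1 (box A) = mu (A ord0) * powm mu k (box (A \o lift ord0)))%E.
Proof.
move=> mA; rewrite /= /cons_measure /pushforward preimage_ins_row_box.
by rewrite product_measure1E//; [exact: mA|apply: measurable_box => i; exact: mA].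
Qed.

Lemma powm_box (mu : {sigma_finite_measure set (measurableTypeR R) -> \bar R}) k (A : 'I_k -> set R) :
  (forall i, measurable (A i)) ->
  powm mu k (box A) = (\prod_(i < k) mu (A i))%E.
Proof.
elim: k A => [|k IH] A mA.
  by rewrite big_ord0 /= diracE mem_set// => -[].
by rewrite powmS_box// big_ord_recl IH// => i; exact: mA.
Qed.

Lemma measurable_row_boxes k :
  @measurable _ 'rV[R]_k = <<s [set box A | A in [set A : 'I_k -> set R | forall i, measurable (A i)]] >>.
Proof.
apply/seteqP; split.
- apply: smallest_sub; first exact: smallest_sigma_algebra.
  rewrite -bigcup_seq/= => _ [i _ [B mB <-]].
  apply: sub_sigma_algebra => /=.
  exists (fun j => if j == i then B else setT).
    by move=> j /=; case: ifP.
  rewrite setTI; apply/seteqP; split => z /= Bz.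
  - by have := Bz i; rewrite eqxx.
  - by move=> j; case: eqP => // ->.
- apply: smallest_sub; first exact: sigma_algebra_measurable.
  by move=> _ [A mA <-]; exact: measurable_box.
Qed.

(** Boxes are stable under intersection and generate the sigma-algebra, and cubes over an exhaustion
    of finite measure cover the space; hence a measure is fixed by its values on boxes. Both
    Fubini's theorem at an arbitrary position and the law of an independent family come from
    this. *)
Lemma powm_unique (mu : {sigma_finite_measure set (measurableTypeR R) -> \bar R}) k
    (m' : {measure set 'rV[R]_k -> \bar R}) :
  (forall A : 'I_k -> set R, (forall i, measurable (A i)) ->
    m' (box A) = (\prod_(i < k) mu (A i))%E) ->
  forall X, measurable X -> powm mu k X = m' X.
Proof.
move=> m'E.
have /sigma_finiteP[F [FT ndF mF]] := sigma_finiteT mu.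
apply: (measure_unique _ (fun n => box (fun=> F n)) (@measurable_row_boxes k)).
- move=> _ _ [A mA <-] [B mB <-]; exists (fun i => A i `&` B i).
    by move=> i; apply: measurableI; [exact: mA|exact: mB].
  apply/seteqP; split => z /= ABz.
  - by split => i; have [] := ABz i.
  - by move=> i; split; [exact: ABz.1|exact: ABz.2].
- by move=> n; exists (fun=> F n) => // i; have [] := mF n.
- apply/seteqP; split => // z _.
  have H i : exists n, F n (z ord0 i).
    have : (\bigcup_i F i) (z ord0 i) by rewrite -FT.
    by case=> n _ Fn; exists n.
  (* As [F] increases, the largest of the finitely many indices serves all coordinates. *)
  exists (\max_i projT1 (cid (H i)))%N => //= i.
  have := projT2 (cid (H i)).
  by apply: (subsetPset _ _ _); apply: ndF; exact: (leq_bigmax i).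
- by move=> _ [A mA <-]; rewrite m'E//; exact: powm_box.
- move=> n; apply: (@le_lt_trans _ _ (\prod_(i < k) mu (F n))%E).
    by rewrite -powm_box// => i; have [] := mF n.
  rewrite ltey_eq prode_fin_num// => i _; have [_ oo] := mF n.
  by rewrite ge0_fin_numE.
Qed.

End row_product_measure.

(** * Integration against a measure with a density *)

Section density.
Context d (T : measurableType d) (R : realType).
Variables (nu : {finite_measure set T -> \bar R}).
Variables (mu : {sigma_finite_measure set T -> \bar R}) (p : T -> R).
Hypothesis mp : measurable_fun setT p.
Hypothesis nuE : forall A, measurable A -> nu A = (\int[mu]_(x in A) (p x)%:E)%E.

(** [p] has the same integral as the Radon-Nikodym derivative of [nu] over every measurable set, so
    the two agree almost everywhere and the change of variables for the derivative carries over. *)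
Lemma ge0_integral_density (f : T -> \bar R) :
  measurable_fun setT f -> (forall x, (0 <= f x)%E) ->
  (\int[nu]_x f x = \int[mu]_x (f x * (p x)%:E))%E.
Proof.
move=> mf f0.
have dom : nu `<< mu.
  apply/null_content_dominatesP => A mA A0; rewrite nuE//.
  apply: null_set_integral => //.
  exact/measurable_funTS/measurable_EFinP.
rewrite -(Radon_Nikodym_SigmaFinite.change_of_variables dom)//.
apply: ae_eq_integral => //.
- apply: emeasurable_funM => //; apply: measurable_int.
  exact: Radon_Nikodym_SigmaFinite.f_integrable.
- apply: emeasurable_funM => //.
  exact/measurable_EFinP.
- apply: ae_eqe_mul2l.
  apply: integral_ae_eq => //.
  + exact: Radon_Nikodym_SigmaFinite.f_integrable.
  + exact/measurable_EFinP.
  + by move=> E _ mE; rewrite -nuE// -Radon_Nikodym_SigmaFinite.f_integral.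
Qed.

End density.

(** * Fubini's theorem at any coordinate, and laws of independent families *)

Section row_product_integral.
Context {R : realType}.
Implicit Types mu : {sigma_finite_measure set (measurableTypeR R) -> \bar R}.
Local Open Scope ereal_scope.

(** On a box, inserting at [l] only pulls the l-th factor out of a commutative product. *)
Lemma powm_ins mu k (l : 'I_k.+1) X : measurable X ->
  powm mu k.+1 X = pushforward (mu \x powm mu k) (@ins_row R k l) X.
Proof.
pose f : {mfun _ >-> _} := HB.pack (@ins_row R k l)
  (isMeasurableFun.Build _ _ _ _ _ (@measurable_ins_row R k l)).
move=> mX; rewrite (_ : @ins_row R k l = f)//.
apply: powm_unique => // A mA.
transitivity ((mu \x powm mu k) (@ins_row R k l @^-1` box A)) => //.
rewrite preimage_ins_row_box product_measure1E//.
- by rewrite powm_box; [rewrite (bigD1_ord l)|move=> i; exact: mA].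
- exact: mA.
- by apply: measurable_box => i; exact: mA.
Qed.

Lemma ge0_integral_ins mu k (l : 'I_k.+1) (f : 'rV[R]_k.+1 -> \bar R) :
  measurable_fun setT f -> (forall z, 0 <= f z) ->
  \int[powm mu k.+1]_z f z = \int[mu]_t \int[powm mu k]_v f (ins_row l (t, v)).
Proof.
move=> mf f0.
transitivity (\int[pushforward (mu \x powm mu k) (@ins_row R k l)]_z f z).
  by apply: eq_measure_integral => [|? A mA _]; [exact: measurable_ins_row|exact: powm_ins].
rewrite ge0_integral_pushforward//=; last exact: measurable_ins_row.
rewrite preimage_setT fubini_tonelli1//.
exact: measurableT_comp (measurable_ins_row l).
Qed.

Lemma integrable_ins mu k (l : 'I_k.+1) (f : 'rV[R]_k.+1 -> \bar R) :
  (powm mu k.+1).-integrable setT f ->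
  (mu \x powm mu k).-integrable setT (f \o @ins_row R k l).
Proof.
move=> /integrableP[mf foo]; apply/integrableP; split.
  exact: measurableT_comp (measurable_ins_row l).
rewrite fubini_tonelli1//=.
  by rewrite -(ge0_integral_ins mu l (f := fun z => `|f z|))//; exact: measurableT_comp.
do 2! apply: measurableT_comp => //; exact: measurable_ins_row.
Qed.

(** Puts the l-th variable innermost, the order in which a partial derivative in that variable can
    be integrated. *)
Lemma integral_ins2 mu k (l : 'I_k.+1) (f : 'rV[R]_k.+1 -> \bar R) :
  (powm mu k.+1).-integrable setT f ->
  \int[powm mu k.+1]_z f z = \int[powm mu k]_v \int[mu]_t f (ins_row l (t, v)).
Proof.
move=> fi; have fi' := integrable_ins l fi.
transitivity (\int[pushforward (mu \x powm mu k) (@ins_row R k l)]_z f z).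
  by apply: eq_measure_integral => [|? A mA _]; [exact: measurable_ins_row|exact: powm_ins].
rewrite integral_pushforward//=.
- by rewrite preimage_setT -integral21_prod_meas1.
- exact: measurable_ins_row.
- exact: measurable_int fi.
Qed.

Lemma powm_law d (T : measurableType d) (P : {measure set T -> \bar R}) mu k
    (X : 'I_k -> T -> R) :
  (forall i, measurable_fun setT (X i)) ->
  (forall A : 'I_k -> set R, (forall i, measurable (A i)) ->
    P (\bigcap_(i in setT) (X i @^-1` A i)) = \prod_(i < k) mu (A i)) ->
  forall f, measurable_fun setT f -> (forall z, 0 <= f z) ->
    \int[P]_w f (\row_i X i w) = \int[powm mu k]_z f z.
Proof.
move=> mX XE f mf f0.
have mrow : measurable_fun setT (fun w => \row_i X i w).
  by apply: measurable_fun_row => i; under eq_fun do rewrite mxE; exact: mX.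
transitivity (\int[pushforward P (fun w => \row_i X i w)]_z f z).
  by rewrite [RHS]ge0_integral_pushforward.
apply: eq_measure_integral => A mA _; apply/esym.
apply: powm_unique => // B mB; rewrite -XE//; congr (P _).
apply/seteqP; split => w /= Bw i.
- by move=> _; have := Bw i; rewrite mxE.
- by rewrite mxE; exact: Bw.
Qed.

Definition lebn k : {sigma_finite_measure set 'rV[R]_k -> \bar R} :=
  powm (@lebesgue_measure R) k.

(** Bridge from the iterated integral in [mvn_cdf] to a measure on rows. *)
Lemma integral_rVE k (f : 'rV[R]_k -> \bar R) :
  measurable_fun setT f -> (forall z, 0 <= f z) ->
  integral_rV f = \int[lebn k]_z f z.
Proof.
elim: k f => [|k IH] f mf f0.
  by rewrite /lebn/= integral_dirac//= diracE mem_set// mul1e.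
rewrite [RHS](ge0_integral_ins _ ord0)//=; apply: eq_integral => t _.
rewrite IH//; first by apply: eq_integral => v _; rewrite row_mx_ins.
under eq_fun do rewrite row_mx_ins.
apply: measurableT_comp => //.
exact: measurableT_comp (measurable_ins_row ord0) (measurable_pair1 t).
Qed.

End row_product_integral.

(** * Triangular changes of variables and the normal density *)

Section affine_change.
Context {R : realType}.
Local Notation mu := (@lebesgue_measure R).

(** The right-hand side is a measure in [A], and half-open intervals determine Lebesgue measure. *)
Lemma lebesgue_measure_affine (s c : R) (A : set R) : s != 0 -> measurable A ->
  mu A = (`|s|%:E * mu ((fun t : R => s * t + c)%R @^-1` A))%E.
Proof.
move=> s0 mA; pose phi := fun t : measurableTypeR R => (s * t + c) : measurableTypeR R.
have mphi : measurable_fun setT phi.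
  by apply: measurable_funD => //; exact: mulrl_measurable.
pose m'' := mscale (NngNum (normr_ge0 s)) (pushforward mu phi).
pose m' : {measure set (measurableTypeR R) -> \bar R} := m'' mphi.
rewrite -[RHS]/(m' A).
apply: (@lebesgue_measure_unique R m') => // _ [[a b]] _ <-.
rewrite -[RHS]/(`|s|%:E * mu (phi @^-1` `]a, b]%classic))%E /=.
have [s_gt0|s_lt0|/eqP] := ltgtP 0 s; last by rewrite eq_sym (negbTE s0).
- rewrite (_ : _ @^-1` _ = `](a - c) / s, (b - c) / s]%classic); last first.
    apply/seteqP; split => t /=; rewrite !in_itv/= ltr_pdivrMr// ler_pdivlMr//;
      by rewrite ltrBlDr lerBrDr mulrC.
  rewrite !lebesgue_measure_itv/= !lte_fin ltr_pM2r ?invr_gt0// ltrD2r.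
  case: ifPn; rewrite ?mule0// => _.
  by rewrite -!EFinB -EFinM gtr0_norm//; congr EFin; field.
(* A negative slope moves the closed end to the other side, without effect on the length. *)
- rewrite (_ : _ @^-1` _ = `[(b - c) / s, (a - c) / s[%classic); last first.
    apply/seteqP; split => t /=; rewrite !in_itv/= ltr_ndivlMr// ler_ndivrMr//;
      by rewrite ltrBlDr lerBrDr mulrC andbC.
  rewrite !lebesgue_measure_itv/= !lte_fin ltr_nM2r ?invr_lt0// ltrD2r.
  case: ifPn; rewrite ?mule0// => _.
  by rewrite -!EFinB -EFinM ltr0_norm//; congr EFin; field.
Qed.

Lemma ge0_integral_affine (s c : R) (f : R -> \bar R) : s != 0 ->
  measurable_fun setT f -> (forall t, 0 <= f t)%E ->
  (`|s|%:E * \int[mu]_t f (s * t + c)%R = \int[mu]_t f t)%E.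
Proof.
move=> s0 mf f0; pose phi := fun t : measurableTypeR R => (s * t + c) : measurableTypeR R.
have mphi : measurable_fun setT phi.
  by apply: measurable_funD => //; exact: mulrl_measurable.
pose m'' := mscale (NngNum (normr_ge0 s)) (pushforward mu phi).
pose m' : {measure set (measurableTypeR R) -> \bar R} := m'' mphi.
transitivity (\int[m']_t f t)%E; last first.
  apply: eq_measure_integral => // A mA _; apply/esym.
  exact: lebesgue_measure_affine.
rewrite ge0_integral_mscale//=; congr *%E.
by rewrite [RHS]ge0_integral_pushforward.
Qed.

Lemma measurable_row_affine k (U : 'M[R]_k) (c : 'rV[R]_k) :
  measurable_fun setT (fun z : 'rV[R]_k => z *m U + c).
Proof.
apply: measurable_fun_row => i; under eq_fun do rewrite !mxE.
apply: measurable_funD => //; apply: measurable_sum => j.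
by apply: measurable_funM => //; exact: measurable_coord.
Qed.

Lemma measurable_integral_ins k (l : 'I_k.+1) (f : 'rV[R]_k.+1 -> \bar R) :
  measurable_fun setT f -> (forall z, 0 <= f z)%E ->
  measurable_fun setT (fun t : R => \int[lebn k]_v f (ins_row l (t, v)))%E.
Proof.
move=> mf f0.
apply: (@measurable_fun_fubini_tonelli_F _ _ (measurableTypeR R) _ R (lebn k)
  (fun p => f (ins_row l p))) => //.
exact: (measurableT_comp mf (measurable_ins_row l)).
Qed.

(** Induction on [k]: the first coordinate of the image depends on the first variable [t] alone, and
    for fixed [t] the others undergo a smaller triangular map followed by a translation that depends
    on [t]. This is why the statement allows a translation [c]. *)
Lemma ge0_integral_triangular k (U : 'M[R]_k) (c : 'rV[R]_k) (f : 'rV[R]_k -> \bar R) :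
  (forall i j : 'I_k, (j < i)%N -> U i j = 0) -> (forall i, U i i != 0) ->
  measurable_fun setT f -> (forall z, 0 <= f z)%E ->
  ((\prod_i `|U i i|)%:E * \int[lebn k]_z f (z *m U + c)%R = \int[lebn k]_z f z)%E.
Proof.
elim: k U c f => [|k IH] U c f tU dU mf f0.
  rewrite big_ord0 mul1e; apply: eq_integral => z _; congr f.
  by apply/rowP => -[].
pose U' := \matrix_(i, j) U (lift ord0 i) (lift ord0 j).
pose w : 'rV_k := \row_j U ord0 (lift ord0 j).
pose c' : 'rV_k := \row_j c ord0 (lift ord0 j).
have insE t v : ins_row ord0 (t, v) *m U + c =
    ins_row ord0 (U ord0 ord0 * t + c ord0 ord0, v *m U' + (t *: w + c')).
  apply/rowP => j; rewrite !mxE big_ord_recl ins_row_id/=.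
  case: (unliftP ord0 j) => [i|] ->.
  - rewrite !mxE; under eq_bigr do rewrite ins_row_lift/=.
    under [in RHS]eq_bigr do rewrite !mxE.
    by rewrite addrA; congr (_ + _); rewrite addrC.
  - rewrite big1 ?addr0 1?mulrC// => i _.
    by rewrite tU ?mulr0.
have mfU : measurable_fun setT (fun z => f (z *m U + c)).
  by apply: measurableT_comp => //; exact: measurable_row_affine.
have mfi : measurable_fun setT (fun p => f (ins_row ord0 p)).
  by apply: measurableT_comp => //; exact: measurable_ins_row.
have mfUi : measurable_fun setT (fun p => f (ins_row ord0 p *m U + c)).
  by apply: (measurableT_comp mfU); exact: measurable_ins_row.
rewrite [in LHS](ge0_integral_ins _ ord0)//.
rewrite [RHS](ge0_integral_ins _ ord0)//.
rewrite -[RHS](ge0_integral_affine (c ord0 ord0) (dU ord0))//; last 2 first.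
- exact: measurable_integral_ins.
- by move=> t; exact: integral_ge0.
rewrite big_ord_recl EFinM -muleA; congr *%E.
rewrite -ge0_integralZl_EFin//; last 3 first.
- by move=> t _; exact: integral_ge0.
- exact: (measurable_integral_ins ord0 mfU).
- by rewrite prodr_ge0.
apply: eq_integral => t _.
under [in LHS]eq_integral do rewrite insE.
rewrite -[RHS](IH U' (t *: w + c')).
- by congr (_%:E * _)%E; apply: eq_bigr => i _; rewrite mxE.
- by move=> i j ij; rewrite mxE tU.
- by move=> i; rewrite mxE.
- exact: measurableT_comp mfi (measurable_pair1 _).
- by [].
Qed.

End affine_change.

(** * The multivariate normal density under linear maps *)

Section mvn_density.
Context {R : realType}.
Local Notation stdn := (@normal_prob R 0 1).

Lemma measurable_quadratic_form k (A : 'M[R]_k) :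
  measurable_fun setT (fun z : 'rV[R]_k => (z *m A *m z^T) ord0 ord0).
Proof.
under eq_fun do rewrite mxE.
apply: measurable_sum => i; apply: measurable_funM.
  under eq_fun do rewrite mxE.
  apply: measurable_sum => j; apply: measurable_funM => //.
  exact: measurable_coord.
by under eq_fun do rewrite mxE; exact: measurable_coord.
Qed.

Lemma measurable_mvn_pdf k (S : 'M[R]_k) : measurable_fun setT (mvn_pdf S).
Proof.
apply: measurable_funM => //; apply: measurableT_comp => //.
apply: measurable_funM => //; apply: measurableT_comp => //.
exact: measurable_quadratic_form.
Qed.

Lemma mvn_pdf_ge0 k (S : 'M[R]_k) z : 0 <= mvn_pdf S z.
Proof. by rewrite /mvn_pdf divr_ge0 ?expR_ge0 ?sqrtr_ge0. Qed.

Lemma mvn_pdfN k (S : 'M[R]_k) z : mvn_pdf S (- z) = mvn_pdf S z.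
Proof. by rewrite /mvn_pdf linearN/= mulmxN !mulNmx opprK. Qed.

(** In the exponent [E] cancels against its inverse; the determinant gains the square of [\det E],
    whose root is the Jacobian factor. It is applied to the triangular [U] with [S] the identity,
    and to [cond_mx]. *)
Lemma mvn_pdf_congr k (E S : 'M[R]_k) (w : 'rV[R]_k) :
  E \in unitmx -> S \in unitmx ->
  mvn_pdf (E^T *m S *m E) (w *m E) * `|\det E| = mvn_pdf S w.
Proof.
move=> uE uS; rewrite /mvn_pdf.
have uET : E^T \in unitmx by rewrite unitmx_tr.
have uG : E^T *m S *m E \in unitmx by rewrite !unitmx_mul uET uS uE.
have -> : w *m E *m invmx (E^T *m S *m E) = w *m invmx S *m invmx E^T.
  apply: (canLR (mulmxK uG)).
  by rewrite !mulmxA mulmxKV// mulmxKV.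
rewrite trmx_mul !mulmxA mulmxKV//.
rewrite !det_mulmx det_tr.
rewrite [X in Num.sqrt X](_ : _ = (\det E) ^+ 2 * ((2 * pi) ^+ k * \det S)); last by ring.
rewrite [Num.sqrt (_ * (_ * _))]sqrtrM ?sqr_ge0// sqrtr_sqr invfM [_^-1 / _]mulrC mulrA.
by rewrite divfK// normr_eq0 -unitfE -unitmxE.
Qed.

Lemma std_normal_pdfE (x : R) :
  normal_pdf 0 1 x = (Num.sqrt (2 * pi))^-1 * expR (- x ^+ 2 / 2).
Proof.
rewrite normal_pdfE ?oner_neq0// /normal_peak /normal_fun subr0 expr1n mul1r.
by rewrite mulr_natl.
Qed.

Lemma mvn_pdf1 k (v : 'rV[R]_k) :
  mvn_pdf 1%:M v = \prod_i normal_pdf 0 1 (v ord0 i).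
Proof.
under eq_bigr do rewrite std_normal_pdfE.
rewrite big_split/= prodr_const card_ord -expR_sum.
rewrite /mvn_pdf invmx1 mulmx1 det1 mulr1 mulrC; congr (_ * expR _).
  by rewrite exprVn; congr (_^-1); elim: k {v} => [|k IH]; rewrite ?expr0 ?sqrtr1//
     !exprS sqrtrM ?IH// mulr_ge0// pi_ge0.
rewrite -mulr_suml sumrN mxE; congr (- _ / 2).
by apply: eq_bigr => i _; rewrite mxE -expr2.
Qed.

Lemma mvn_pdf_block k (M : 'M[R]_k) (t : R) (y : 'rV[R]_k) : M \in unitmx ->
  mvn_pdf (block_mx (1%:M : 'M[R]_1) 0 0 M : 'M[R]_(1 + k)) (row_mx (t%:M : 'M[R]_1) y)
  = normal_pdf 0 1 t * mvn_pdf M y.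
Proof.
move=> uM; rewrite /mvn_pdf std_normal_pdfE.
rewrite invmx_block_diag; last first.
  by rewrite unitmxE det_ublock det1 mul1r -unitmxE.
rewrite invmx1 mul_row_block !mulmx0 addr0 add0r mulmx1 tr_row_mx mul_row_col.
rewrite det_ublock det1 mul1r tr_scalar_mx -scalar_mxM !mxE eqxx mulr1n.
rewrite [in RHS](mulrC _^-1) [RHS]mulrACA -expRD -mulrDl -opprD -expr2; congr (_ * _).
by rewrite -invfM -sqrtrM ?exprS ?mulrA// mulr_ge0// pi_ge0.
Qed.

Local Open Scope ereal_scope.

Lemma ge0_integral_std_normal k (f : 'rV[R]_k -> \bar R) :
  measurable_fun setT f -> (forall z, 0 <= f z) ->
  \int[powm stdn k]_z f z = \int[lebn k]_z (f z * (\prod_i normal_pdf 0 1 (z ord0 i))%:E).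
Proof.
elim: k f => [|k IH] f mf f0.
  by apply: eq_integral => z _; rewrite big_ord0 mule1.
have mpdf l : measurable_fun setT
    (fun z : 'rV[R]_l => \prod_i normal_pdf 0 1 (z ord0 i) : R)%R.
  apply: measurable_prod => i _.
  exact: (measurableT_comp (measurable_normal_pdf 0 1) (measurable_coord i)).
have pdf0 l (z : 'rV[R]_l) : (0 <= \prod_i normal_pdf 0 1 (z ord0 i) :> R)%R.
  by apply: prodr_ge0 => i _; exact: normal_pdf_ge0.
have mg l : measurable_fun setT
    (fun z : 'rV[R]_l => (\prod_i normal_pdf 0 1 (z ord0 i))%:E : \bar R).
  by apply/measurable_EFinP; exact: mpdf.
have mfi : measurable_fun setT (fun p => f (ins_row ord0 p)).
  exact: (measurableT_comp mf (measurable_ins_row ord0)).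
have mh : measurable_fun setT (fun z => f z * (\prod_i normal_pdf 0 1 (z ord0 i))%:E).
  by apply: emeasurable_funM => //; exact: mg.
rewrite (ge0_integral_ins _ ord0)//.
rewrite [RHS](ge0_integral_ins _ ord0)//; last first.
  by move=> z; rewrite mule_ge0// lee_fin.
rewrite (ge0_integral_density (mu := lebesgue_measure) (p := normal_pdf 0 1))//; last 3 first.
- exact: measurable_normal_pdf.
- apply: (@measurable_fun_fubini_tonelli_F _ _ (measurableTypeR R) _ R (powm stdn k)
    (fun p => f (ins_row ord0 p))) => //.
- by move=> t; exact: integral_ge0.
apply: eq_integral => t _.
have mft : measurable_fun setT (fun v => f (ins_row ord0 (t, v))).
  exact: measurableT_comp mfi (measurable_pair1 _).
rewrite IH// -ge0_integralZr//; last 3 first.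
- by apply: emeasurable_funM => //; exact: mg.
- by move=> v _; rewrite mule_ge0// lee_fin.
- by rewrite lee_fin normal_pdf_ge0.
apply: eq_integral => v _; rewrite big_ord_recl ins_row_id -muleA -EFinM mulrC.
by under [in RHS]eq_bigr do rewrite ins_row_lift.
Qed.

(** After the triangular substitution, [mvn_pdf_congr] at the identity matrix absorbs the Jacobian
    and leaves the product of standard densities. *)
Lemma ge0_integral_mvn k (U : 'M[R]_k) (f : 'rV[R]_k -> \bar R) :
  (forall i j : 'I_k, (j < i)%N -> U i j = 0%R) -> (forall i, U i i != 0)%R ->
  measurable_fun setT f -> (forall z, 0 <= f z) ->
  \int[powm stdn k]_v f (v *m U)%R = \int[lebn k]_z (f z * (mvn_pdf (U^T *m U) z)%:E).
Proof.
move=> tU dU mf f0.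
have dtU : (\det U = \prod_i U i i)%R.
  by rewrite -det_tr det_trig; [apply: eq_bigr => i _; rewrite mxE|
    apply/is_trig_mxP => i j ij; rewrite mxE tU].
have uU : U \in unitmx.
  rewrite unitmxE dtU unitfE; apply/prodf_neq0 => i _; exact: dU.
have mfU : measurable_fun setT (fun z => f (z *m U)%R).
  apply: (measurableT_comp mf); have := measurable_row_affine U 0.
  by under eq_fun do rewrite addr0.
have mm : measurable_fun setT (fun z => f z * (mvn_pdf (U^T *m U) z)%:E).
  by apply: emeasurable_funM => //; apply/measurable_EFinP; exact: measurable_mvn_pdf.
rewrite ge0_integral_std_normal//.
rewrite -[RHS](ge0_integral_triangular 0 tU dU)//; last first.
  by move=> z; rewrite mule_ge0// lee_fin mvn_pdf_ge0.
rewrite -ge0_integralZl_EFin//; last 3 first.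
- by move=> z _; rewrite mule_ge0// lee_fin mvn_pdf_ge0.
- apply: (measurableT_comp mm); exact: measurable_row_affine.
- exact: prodr_ge0.
apply: eq_integral => z _; rewrite addr0 -mvn_pdf1 -(mvn_pdf_congr z uU (unitmx1 _ _)).
by rewrite mulmx1 dtU normr_prod muleCA -EFinM mulrC.
Qed.

End mvn_density.

(** * Moments of the normal law *)

Section gaussian_moments.
Context {R : realType}.
Local Notation mu := (@lebesgue_measure R).
Local Notation phi := (@normal_pdf R 0 1).

(** Fundamental theorem on [[u n, v n]], then dominated convergence with bound [|f|]. Keeping the
    end points abstract treats half-lines and the whole line together. *)
Lemma integral_derive_ray_seq (F f : R -> R) (B : \bar R) (u v : R^nat) (L : R) :
  (forall x : R, is_derive x 1 F (- f x)) -> continuous f ->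
  mu.-integrable setT (EFin \o f) ->
  (forall n, u n < v n) ->
  (forall t, \forall n \near \oo, (u n <= t <= v n) = (B <= t%:E)%E) ->
  F (u n) @[n --> \oo] --> L -> F (v n) @[n --> \oo] --> (0 : R) ->
  (\int[mu]_t (if (B <= t%:E)%E then (f t)%:E else 0) = L%:E)%E.
Proof.
move=> dF cf intf uv uvB FL F0.
have mf : measurable_fun setT f by exact: continuous_measurable_fun.
have mB : measurable_fun setT (fun t : R => (B <= t%:E)%E).
  exact: measurable_fun_lee.
pose g n t : \bar R := if u n <= t <= v n then (f t)%:E else 0%E.
have cvgi : (\int[mu]_t g n t)%E @[n --> \oo] -->
    (\int[mu]_t (if (B <= t%:E)%E then (f t)%:E else 0))%E.
  pose D := @dominated_convergence _ _ _ mu setT measurableT g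
    (fun t => if (B <= t%:E)%E then (f t)%:E else 0)%E (fun t => `|(f t)%:E|)%E.
  have [] // := D.
  - move=> n; apply: measurable_fun_ifT => //; last exact/measurable_EFinP.
    by apply: measurable_and; exact: measurable_fun_ler.
  - apply: measurable_fun_ifT => //; exact/measurable_EFinP.
  - apply: aeW => t _; apply: cvg_near_cst.
    by near=> n; rewrite /g; have -> : (u n <= t <= v n) = (B <= t%:E)%E by near: n; exact: uvB.
  - exact: integrable_abse.
  - by apply: aeW => t n _; rewrite /g; case: ifP; rewrite // abse0.
have gE n : (\int[mu]_t g n t = (F (u n) - F (v n))%:E)%E.
  transitivity (\int[mu]_(t in `[u n, v n]) (f t)%:E)%E.
    rewrite [RHS]integral_mkcond; apply: eq_integral => t _.
    by rewrite /g patchE mem_setE in_itv.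
  rewrite (@continuous_FTC2 _ f (fun y => - F y))//.
  - by rewrite -EFinB opprK addrC.
  - exact: continuous_subspaceT.
  - have dN (x : R) : derivable (fun y => - F y) x 1.
      by apply: derivableN; have [] := dF x.
    have cN : continuous (fun y => - F y).
      by move=> x; apply: differentiable_continuous; exact/derivable1_diffP.
    split; [by move=> x _; exact: dN| |].
    + exact/cvg_at_right_filter/cN.
    + exact/cvg_at_left_filter/cN.
  - move=> z _; have [dFz Fz] := dF z.
    by rewrite derive1E deriveN// Fz opprK.
apply/esym; have/cvg_lim <-// := cvgi.
apply/esym/cvg_lim => //; under eq_fun do rewrite gE.
apply: cvg_EFin; first exact: nearW.
by rewrite -[L]subr0; exact: cvgB.
Unshelve. all: by end_near. Qed.

(** The value 0 at infinite [B] has two sources: the ray is empty at [+oo], while at [-oo] the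
    limits of [F] at both ends are 0. *)
Lemma integral_derive_ray (F f : R -> R) (B : \bar R) :
  (forall x : R, is_derive x 1 F (- f x)) -> continuous f ->
  mu.-integrable setT (EFin \o f) ->
  F x @[x --> +oo] --> (0 : R) -> F x @[x --> -oo] --> (0 : R) ->
  (\int[mu]_t (if (B <= t%:E)%E then (f t)%:E else 0)
   = (if B is r%:E then F r else 0)%:E)%E.
Proof.
move=> dF cf intf F0 FN0; case: B => [r| |].
- apply: (integral_derive_ray_seq (F := F) (u := fun=> r) (v := fun n => r + n.+1%:R)) => //.
  + by move=> n; rewrite ltrDl.
  + move=> t; near=> n; rewrite lee_fin andb_idr// => _.
    rewrite -lerBlDl (@le_trans _ _ n%:R)// ?ler_nat//.
    by near: n; exact: nbhs_infty_ger.
  + exact: cvg_cst.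
  + apply: (cvg_comp _ F _ F0); apply/cvgryPge => A; near=> n.
    rewrite -lerBlDl (@le_trans _ _ n%:R)// ?ler_nat//.
    by near: n; exact: nbhs_infty_ger.
- by rewrite integral0_eq.
- apply: (integral_derive_ray_seq (F := F) (u := fun n => - n.+1%:R) (v := fun n => n.+1%:R)) => //.
  + by move=> n; rewrite (lt_trans (y := 0)) ?oppr_lt0.
  + move=> t; near=> n; rewrite leNye -ler_norml.
    rewrite (@le_trans _ _ n%:R)// ?ler_nat//.
    by near: n; exact: nbhs_infty_ger.
  + apply: (cvg_comp _ F _ FN0); apply/cvgrNyPle => A; near=> n.
    rewrite lerNl (@le_trans _ _ n%:R)// ?ler_nat//.
    by near: n; exact: nbhs_infty_ger.
  + apply: (cvg_comp _ F _ F0); apply/cvgryPge => A; near=> n.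
    rewrite (@le_trans _ _ n%:R)// ?ler_nat//.
    by near: n; exact: nbhs_infty_ger.
Unshelve. all: by end_near. Qed.

Lemma is_derive_std_normal_pdf (x : R) : is_derive x 1 phi (- (x * phi x)).
Proof.
pose q : R -> R := (- 2^-1) *: (@idfun R * @idfun R).
have dq : is_derive x 1 q (- x).
  by apply: is_derive_eq; rewrite /GRing.scale/= /GRing.scale/=; field.
pose g : R -> R := (Num.sqrt (2 * pi))^-1 *: (expR \o q).
have phiE : phi = g.
  apply/funext => y; rewrite std_normal_pdfE; congr (_ * expR _).
  by rewrite /q -[RHS]/(- 2^-1 * (y * y)); field.
rewrite phiE.
apply: is_derive_eq.
by rewrite /g /GRing.scale/= /GRing.scale/=; ring.
Qed.

(* Half of the exponent absorbs the polynomial, as [1 + u <= expR u]. *)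
Lemma sqrM_std_normal_pdf_le (x : R) :
  (1 + x ^+ 2) * phi x <= 4 * (Num.sqrt (2 * pi))^-1 * normal_fun 0 (Num.sqrt 2) x.
Proof.
rewrite std_normal_pdfE mulrCA -mulrA [leRHS]mulrCA ler_wpM2l ?invr_ge0 ?sqrtr_ge0//.
rewrite /normal_fun subr0 sqr_sqrtr//.
have -> : - x ^+ 2 / 2 = - x ^+ 2 / (2 *+ 2) + - x ^+ 2 / (2 *+ 2) by field.
rewrite expRD mulrA ler_wpM2r ?expR_ge0//.
rewrite mulNr expRN ler_pdivrMr ?expR_gt0//.
(* The factor 4 compensates the denominator 4, making the coefficient of [x ^+ 2] equal to 1. *)
apply: (@le_trans _ _ (4 * (1 + x ^+ 2 / (2 *+ 2)))).
  have -> : 4 * (1 + x ^+ 2 / (2 *+ 2)) = 4 + x ^+ 2 by field.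
  by rewrite lerD2r ler1n.
by rewrite ler_wpM2l// expR_ge1Dx.
Qed.

Lemma integrable_sqrM_std_normal_pdf :
  mu.-integrable setT (EFin \o (fun x : R => (1 + x ^+ 2) * phi x)).
Proof.
have mphi : measurable_fun setT (fun x : R => (1 + x ^+ 2) * phi x).
  apply: measurable_funM; last exact: measurable_normal_pdf.
  by apply: measurable_funD => //; exact: measurable_funX.
have s0 : Num.sqrt (2 : R) != 0 by rewrite gt_eqF// sqrtr_gt0.
(* The dominating function is a multiple of the normal density of variance 2; dividing by
   [normal_peak] removes the normalization of the latter. *)
have h : mu.-integrable setT (fun x =>
   (4 * (Num.sqrt (2 * pi))^-1 / normal_peak (Num.sqrt 2))%:E
    * (normal_pdf (0 : R) (Num.sqrt 2) x)%:E)%E.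
  by apply: integrableZl => //; exact: integrable_normal_pdf.
apply: le_integrable h => //; first exact/measurable_EFinP.
move=> x _ /=; rewrite lee_fin ger0_norm; last first.
  by rewrite mulr_ge0 ?normal_pdf_ge0// addr_ge0 ?sqr_ge0.
apply: le_trans (ler_norm _); apply: le_trans (sqrM_std_normal_pdf_le x) _.
by rewrite normal_pdfE// -!mulrA mulKf// gt_eqF// normal_peak_gt0.
Qed.

Lemma integrable_dominated_std_normal_pdf (g : R -> R) :
  measurable_fun setT g -> (forall x, `|g x| <= 1 + x ^+ 2) ->
  mu.-integrable setT (EFin \o (fun x => g x * phi x)).
Proof.
move=> mg gle; apply: le_integrable integrable_sqrM_std_normal_pdf => //.
  apply/measurable_EFinP/measurable_funM => //.
  exact: measurable_normal_pdf.
move=> x _ /=; rewrite lee_fin !normrM ler_wpM2r//.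
by apply: le_trans (gle x) (ler_norm _).
Qed.

Lemma norm_le1_sqr (x : R) : `|x| <= 1 + x ^+ 2.
Proof. by rewrite ler_norml; apply/andP; split; nra. Qed.

(** [x * g x * phi x] is bounded, so [g x * phi x] is at most a constant over [x]. *)
Lemma cvg_dominated_std_normal_pdf (g : R -> R) :
  (forall x, `|x * g x| <= 1 + x ^+ 2) ->
  g x * phi x @[x --> +oo] --> (0 : R).
Proof.
move=> gle; pose c := (4 * (Num.sqrt (2 * pi))^-1 : R).
apply/cvgr0Pnorm_le => e e0; near=> x.
have x0 : 0 < x by near: x; exact: nbhs_pinfty_gt.
have : `|x * g x * phi x| <= c.
  rewrite normrM (ger0_norm (normal_pdf_ge0 _ _ _)).
  apply: (@le_trans _ _ ((1 + x ^+ 2) * phi x)).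
    by rewrite ler_wpM2r ?normal_pdf_ge0.
  apply: le_trans (sqrM_std_normal_pdf_le x) _.
  rewrite -[leRHS]mulr1 ler_wpM2l ?mulr_ge0 ?invr_ge0 ?sqrtr_ge0//.
  rewrite /normal_fun -expR0 ler_expR mulNr oppr_le0 divr_ge0 ?mulrn_wge0 ?sqr_ge0//.
rewrite -mulrA normrM gtr0_norm// mulrC -ler_pdivlMr// => /le_trans; apply.
by rewrite ler_pdivrMr// mulrC -ler_pdivrMr.
Unshelve. all: by end_near. Qed.

Lemma std_normal_pdfN (x : R) : phi (- x) = phi x.
Proof. by rewrite !std_normal_pdfE sqrrN. Qed.

Lemma cvgNy_dominated_std_normal_pdf (g : R -> R) :
  (forall x, `|x * g x| <= 1 + x ^+ 2) ->
  g x * phi x @[x --> -oo] --> (0 : R).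
Proof.
move=> gle; apply/cvgNy_compNP.
have := @cvg_dominated_std_normal_pdf (g \o -%R).
under eq_fun do rewrite -std_normal_pdfN.
by apply=> x; rewrite -normrN -mulNr -(sqrrN x); exact: gle.
Qed.

(** [t * phi t] is minus the derivative of [phi]; this is Tallis' formula in dimension one. *)
Lemma integral_id_std_normal_pdf_ray (B : \bar R) :
  (\int[mu]_t (if (B <= t%:E)%E then (t * phi t)%:E else 0)
   = (std_normal_pdf B)%:E)%E.
Proof.
rewrite (integral_derive_ray B is_derive_std_normal_pdf).
- by case: B.
- by move=> x; apply: continuousM => //; exact: continuous_normal_pdf (oner_neq0 _) _.
- exact: integrable_dominated_std_normal_pdf norm_le1_sqr.
- under eq_fun do rewrite -[phi _]mul1r.
  by apply: (cvg_dominated_std_normal_pdf (g := fun=> 1)) => x; rewrite mulr1 norm_le1_sqr.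
- under eq_fun do rewrite -[phi _]mul1r.
  by apply: (cvgNy_dominated_std_normal_pdf (g := fun=> 1)) => x; rewrite mulr1 norm_le1_sqr.
Qed.

Lemma integral_id_std_normal_pdf : (\int[mu]_t (t * phi t)%:E = 0)%E.
Proof.
have := integral_id_std_normal_pdf_ray -oo%E.
by under eq_integral do rewrite leNye.
Qed.

(* [(x ^+ 2 - 1) * phi x] is minus the derivative of [x * phi x]. *)
Lemma integral_sqr_std_normal_pdf : (\int[mu]_t (t ^+ 2 * phi t)%:E = 1)%E.
Proof.
have dF (x : R) : is_derive x 1 ((@idfun R) * phi) (- ((x ^+ 2 - 1) * phi x)).
  have := is_derive_std_normal_pdf x => h.
  by apply: is_derive_eq; rewrite /GRing.scale/=; ring.
have i1 : mu.-integrable setT (EFin \o (fun x => (x ^+ 2 - 1) * phi x)).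
  apply: integrable_dominated_std_normal_pdf.
    by apply: measurable_funB => //; exact: measurable_funX.
  by move=> x; rewrite (le_trans (ler_normB _ _))// normr1 ger0_norm ?sqr_ge0// addrC.
have i2 : mu.-integrable setT (EFin \o phi) by exact: integrable_normal_pdf.
have h0 : (@idfun R * phi) x @[x --> +oo] --> (0:R).
  by apply: (@cvg_dominated_std_normal_pdf id) => x; rewrite -expr2 ger0_norm ?sqr_ge0// lerDr.
have h1 : (@idfun R * phi) x @[x --> -oo] --> (0:R).
  by apply: (@cvgNy_dominated_std_normal_pdf id) => x; rewrite -expr2 ger0_norm ?sqr_ge0// lerDr.
have cf : continuous (fun x : R => (x ^+ 2 - 1) * phi x).
  move=> x; apply: (@continuousM R R (fun x => x ^+ 2 - 1) phi); last first.
    exact: continuous_normal_pdf (oner_neq0 _) _.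
  by apply: continuousB; [exact: exprn_continuous|exact: cvg_cst].
have := integral_derive_ray -oo%E dF cf i1 h0 h1.
under eq_integral do rewrite leNye.
move=> h; transitivity (\int[mu]_t (((t ^+ 2 - 1) * phi t)%:E + (phi t)%:E))%E.
  by apply: eq_integral => t _; rewrite -EFinD; congr EFin; ring.
rewrite integralD_EFin//; transitivity (0 + 1 : \bar R)%E; last by rewrite add0e.
congr (_ + _)%E; first exact: h.
exact: integral_normal_pdf.
Qed.

End gaussian_moments.

Section signed_density.
Context d (T : measurableType d) (R : realType).
Implicit Types (f : T -> \bar R) (p : T -> R).
Local Open Scope ereal_scope.

Lemma funeposMr f p : (forall x, 0 <= p x)%R ->
  (fun x => f x * (p x)%:E)^\+ = (fun x => f^\+ x * (p x)%:E).
Proof.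
move=> p0; apply/funext => x.
have /(congr1 (@^~ x)) := ge0_funeposM f (p0 x).
by rewrite !funeposE ![_ * (p x)%:E]muleC.
Qed.

Lemma funenegMr f p : (forall x, 0 <= p x)%R ->
  (fun x => f x * (p x)%:E)^\- = (fun x => f^\- x * (p x)%:E).
Proof.
move=> p0; apply/funext => x.
have /(congr1 (@^~ x)) := ge0_funenegM f (p0 x).
by rewrite !funenegE ![_ * (p x)%:E]muleC.
Qed.

Lemma integral_density (nu : {finite_measure set T -> \bar R})
    (mu : {sigma_finite_measure set T -> \bar R}) p f :
  measurable_fun setT p -> (forall x, 0 <= p x)%R ->
  (forall A, measurable A -> nu A = \int[mu]_(x in A) (p x)%:E) ->
  measurable_fun setT f ->
  \int[nu]_x f x = \int[mu]_x (f x * (p x)%:E).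
Proof.
move=> mp p0 nuE mf; rewrite integralE [RHS]integralE funeposMr// funenegMr//.
congr (_ - _); rewrite (ge0_integral_density mp nuE)//.
- exact: measurable_funepos.
- exact: measurable_funeneg.
Qed.

End signed_density.

(** * First and second moments of Gaussian rows *)

Section row_moments.
Context {R : realType}.
Local Notation stdn := (@normal_prob R 0 1).
Local Open Scope ereal_scope.

Lemma integral_mvn k (U : 'M[R]_k) (f : 'rV[R]_k -> \bar R) :
  (forall i j : 'I_k, (j < i)%N -> U i j = 0%R) -> (forall i, U i i != 0)%R ->
  measurable_fun setT f ->
  \int[powm stdn k]_v f (v *m U)%R = \int[lebn k]_z (f z * (mvn_pdf (U^T *m U) z)%:E).
Proof.
move=> tU dU mf; have p0 := mvn_pdf_ge0 (U^T *m U).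
rewrite integralE [RHS]integralE funeposMr// funenegMr//.
rewrite -!(ge0_integral_mvn tU dU)//.
- by congr (_ - _); apply: eq_integral => v _; rewrite ?funeposE ?funenegE.
- exact: measurable_funeneg.
- exact: measurable_funepos.
Qed.

Lemma powm_law_signed d (T : measurableType d) (P : {measure set T -> \bar R})
    (mu : {sigma_finite_measure set (measurableTypeR R) -> \bar R}) k (X : 'I_k -> T -> R) :
  (forall i, measurable_fun setT (X i)) ->
  (forall A : 'I_k -> set R, (forall i, measurable (A i)) ->
    P (\bigcap_(i in setT) (X i @^-1` A i)) = \prod_(i < k) mu (A i)) ->
  forall f, measurable_fun setT f ->
    \int[P]_w f (\row_i X i w)%R = \int[powm mu k]_z f z.
Proof.
move=> mX XE f mf; rewrite integralE [RHS]integralE; rewrite -!(powm_law mX XE)//.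
- by congr (_ - _); apply: eq_integral => v _; rewrite ?funeposE ?funenegE.
- exact: measurable_funeneg.
- exact: measurable_funepos.
Qed.

Lemma powm_setT (P : probability (measurableTypeR R) R) k : powm P k setT = 1.
Proof.
have -> : [set: 'rV[R]_k] = box (fun=> setT) by apply/seteqP; split.
rewrite powm_box//; elim: k => [|k IH]; first by rewrite big_ord0.
by rewrite big_ord_recl IH mule1; exact: probability_setT.
Qed.

Lemma ge0_integral_powm_coord (P : probability (measurableTypeR R) R) k (l : 'I_k) (f : R -> \bar R) :
  measurable_fun setT f -> (forall t, 0 <= f t) ->
  \int[powm P k]_z f (z ord0 l) = \int[P]_t f t.
Proof.
case: k l => [[]//|k] l mf f0.
rewrite (ge0_integral_ins _ l)//; last exact: measurableT_comp (measurable_coord l).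
apply: eq_integral => t _; rewrite -[RHS]mule1 -(powm_setT P k).
rewrite -integral_cst//; first by apply: eq_integral => v _; rewrite ins_row_id.
Qed.

Lemma integral_std_normal_prob (f : R -> \bar R) : measurable_fun setT f ->
  \int[stdn]_t f t = \int[lebesgue_measure]_t (f t * (normal_pdf 0 1 t)%:E).
Proof.
move=> mf; apply: (integral_density (mu := @lebesgue_measure R)) => //.
- exact: measurable_normal_pdf.
- by move=> t; exact: normal_pdf_ge0.
Qed.

Lemma integral_sqr_stdn : \int[stdn]_t (t ^+ 2)%:E = 1.
Proof.
rewrite integral_std_normal_prob; first exact: integral_sqr_std_normal_pdf.
by apply/measurable_EFinP; exact: measurable_funX.
Qed.

Lemma integrable_id_stdn : stdn.-integrable setT (fun t => t%:E).
Proof.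
have sqri : stdn.-integrable setT (fun t => (t ^+ 2)%:E).
  apply/integrableP; split.
    by apply/measurable_EFinP; exact: measurable_funX.
  under eq_integral do rewrite /= ger0_norm ?sqr_ge0//.
  by rewrite integral_sqr_stdn ltry.
have h := integrableD measurableT (finite_measure_integrable_cst stdn 1 measurableT) sqri.
apply: (@le_integrable _ _ _ stdn setT measurableT _ _ _ _ h).
  exact/measurable_EFinP.
by move=> t _; rewrite lee_fin (le_trans (norm_le1_sqr _))// ler_norm.
Qed.

Lemma integral_id_stdn : \int[stdn]_t t%:E = 0.
Proof.
rewrite integral_std_normal_prob; first exact: integral_id_std_normal_pdf.
exact/measurable_EFinP.
Qed.

Lemma integral_powm_sqr k (l : 'I_k) : \int[powm stdn k]_z (z ord0 l ^+ 2)%:E = 1.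
Proof.
transitivity (\int[stdn]_t (t ^+ 2)%:E); last exact: integral_sqr_stdn.
apply: (ge0_integral_powm_coord stdn l (f := fun t => (t ^+ 2)%:E)).
- by apply/measurable_EFinP; exact: measurable_funX.
- by move=> t; rewrite lee_fin sqr_ge0.
Qed.

Lemma integrable_powm_sqr k (l : 'I_k) :
  (powm stdn k).-integrable setT (fun z => (z ord0 l ^+ 2)%:E).
Proof.
apply/integrableP; split.
  by apply/measurable_EFinP; apply: measurable_funX; exact: measurable_coord.
under eq_integral do rewrite /= ger0_norm ?sqr_ge0//.
by rewrite integral_powm_sqr ltry.
Qed.

Lemma integrable_powm_cst k (r : R) : (powm stdn k).-integrable setT (cst r%:E).
Proof.
apply/integrableP; split => //=.
rewrite integral_cst//.
suff h : powm stdn k setT = 1 by rewrite [X in _ * X]h mule1 ltry.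
exact: powm_setT.
Qed.

Lemma integrable_powm_coord k (l : 'I_k) :
  (powm stdn k).-integrable setT (fun z => (z ord0 l)%:E).
Proof.
apply: le_integrable (integrableD measurableT (integrable_powm_cst k 1) (integrable_powm_sqr l)) => //.
  by apply/measurable_EFinP; exact: measurable_coord.
by move=> z _; rewrite lee_fin (le_trans (norm_le1_sqr _))// ler_norm.
Qed.

Lemma integrable_powm_mul k (r s : 'I_k) :
  (powm stdn k).-integrable setT (fun z => (z ord0 r * z ord0 s)%:E).
Proof.
apply: le_integrable (integrableD measurableT (integrable_powm_sqr r) (integrable_powm_sqr s)) => //.
  by apply/measurable_EFinP; apply: measurable_funM; exact: measurable_coord.
move=> z _; rewrite lee_fin; apply: le_trans (ler_norm _).
by rewrite ler_norml; apply/andP; split; nra.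
Qed.

Lemma integral_powm_coord k (l : 'I_k) : \int[powm stdn k]_z (z ord0 l)%:E = 0.
Proof.
case: k l => [[]//|k] l.
rewrite (integral_ins2 l)//; last exact: integrable_powm_coord.
apply: integral0_eq => v _.
by under eq_integral do rewrite ins_row_id; exact: integral_id_stdn.
Qed.

(** For distinct coordinates, the inner integral over one of them is a multiple of its mean 0. *)
Lemma integral_powm_mul k (r s : 'I_k) :
  \int[powm stdn k]_z (z ord0 r * z ord0 s)%:E = (r == s)%:R%:E.
Proof.
case: eqVneq => [->|]; first by under eq_integral do rewrite -expr2; exact: integral_powm_sqr.
case: k r s => [[]//|k] r s; rewrite eq_sym; case: (unliftP r s) => [s'|] ->; last by rewrite eqxx.
move=> _.
rewrite (integral_ins2 r)//; last exact: integrable_powm_mul.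
apply: integral0_eq => v _.
under eq_integral do rewrite ins_row_id ins_row_lift EFinM.
rewrite integralZr//; first by rewrite [X in X * _]integral_id_stdn mul0e.
exact: integrable_id_stdn.
Qed.

Lemma integrable_powm_mulmx k (U : 'M[R]_k) (l : 'I_k) :
  (powm stdn k).-integrable setT (fun v => ((v *m U) ord0 l)%:E).
Proof.
under eq_fun do rewrite mxE -sumEFin.
apply: integrable_sum => //= j _.
under eq_fun do rewrite mulrC EFinM.
by apply: integrableZl => //; exact: integrable_powm_coord.
Qed.

Lemma integral_powm_mulmx_mul k (U : 'M[R]_k) (l m : 'I_k) :
  \int[powm stdn k]_v ((v *m U) ord0 l * (v *m U) ord0 m)%:E = ((U^T *m U) l m)%:E.
Proof.
under eq_integral do rewrite !mxE big_distrlr/= -sumEFin.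
rewrite integral_sum//=; last first.
  move=> r; under eq_fun do rewrite -sumEFin.
  apply: integrable_sum => //= s _; under eq_fun do rewrite mulrACA mulrC EFinM.
  by apply: integrableZl => //; exact: integrable_powm_mul.
rewrite !mxE -sumEFin; apply: eq_bigr => r _.
under eq_integral do rewrite -sumEFin.
rewrite integral_sum//=; last first.
  move=> s; under eq_fun do rewrite mulrACA mulrC EFinM.
  by apply: integrableZl => //; exact: integrable_powm_mul.
rewrite (bigD1 r)//= big1 ?adde0.
- under eq_integral do rewrite mulrACA mulrC EFinM.
  rewrite integralZl//; last exact: integrable_powm_mul.
  by rewrite integral_powm_mul eqxx mule1 mxE.
- move=> s rs; under eq_integral do rewrite mulrACA mulrC EFinM.
  rewrite integralZl//; last exact: integrable_powm_mul.
  by rewrite integral_powm_mul eq_sym (negbTE rs) mule0.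
Qed.

Lemma integrable_lebn_mvn k (U : 'M[R]_k) (f : 'rV[R]_k -> \bar R) :
  (forall i j : 'I_k, (j < i)%N -> U i j = 0%R) -> (forall i, U i i != 0)%R ->
  measurable_fun setT f ->
  (powm stdn k).-integrable setT (fun v => f (v *m U)%R) ->
  (lebn k).-integrable setT (fun z => f z * (mvn_pdf (U^T *m U) z)%:E).
Proof.
move=> tU dU mf /integrableP[_ foo].
apply/integrableP; split.
  by apply: emeasurable_funM => //; apply/measurable_EFinP; exact: measurable_mvn_pdf.
under eq_integral => z _ do
  rewrite abseM (gee0_abs (x := (mvn_pdf _ _)%:E)) ?lee_fin ?mvn_pdf_ge0//.
rewrite -(ge0_integral_mvn tU dU (f := fun z => `|f z|))//.
exact: measurableT_comp.
Qed.

End row_moments.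

(** * Truncated moments of a Gaussian vector *)

Section gaussian_conditioning.
Context {R : realType}.

(* [row_mx t y *m cond_mx l c D] is the vector with t at position l and
   y_j D_j + t c_j at the j-th other position: for c the correlations with
   coordinate l and D the conditional standard deviations, it rebuilds a Gaussian
   vector from its l-th coordinate and the standardized residuals. *)
Definition cond_mx k (l : 'I_k.+1) (c D : 'rV[R]_k) : 'M[R]_(1 + k, k.+1) :=
  col_mx (ins_row l (1, c)) (\matrix_(i, j) ((j == lift l i)%:R * D ord0 i)).

Lemma mul_row_cond_mx k (l : 'I_k.+1) (c D : 'rV[R]_k) (t : R) (y : 'rV[R]_k) :
  row_mx (t%:M : 'M[R]_1) y *m cond_mx l c D
  = ins_row l (t, y *m diag_mx D + t *: c).
Proof.
rewrite /cond_mx mul_row_col mul_scalar_mx; apply/rowP => j.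
case: (unliftP l j) => [j'|] ->; rewrite ?ins_row_lift ?ins_row_id/=.
- rewrite !mxE liftK addrC; congr (_ + _); apply: eq_bigr => i _.
  by rewrite !mxE (inj_eq lift_inj) eq_sym; case: eqP => [->|]; rewrite ?mul1r ?mul0r ?mulr0n.
- rewrite !mxE unlift_none mulr1 big1 ?addr0// => i _.
  by rewrite !mxE (negbTE (neq_lift _ _)) mul0r mulr0.
Qed.

Lemma cond_mx_ord0 k (l : 'I_k.+1) (c D : 'rV[R]_k) :
  (cond_mx l c D : 'M[R]_k.+1) ord0 l = 1.
Proof.
rewrite (_ : ord0 = lshift k (ord0 : 'I_1)); last exact/val_inj.
by apply: etrans (col_mxEu _ _ _ _) _; rewrite ins_row_id.
Qed.

Lemma cond_mx_lift k (l : 'I_k.+1) (c D : 'rV[R]_k) i j :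
  (cond_mx l c D : 'M[R]_k.+1) (lift ord0 i) j = (j == lift l i)%:R * D ord0 i.
Proof.
rewrite (_ : lift ord0 i = rshift 1 i); last exact/val_inj.
by apply: etrans (col_mxEd _ _ _ _) _; rewrite mxE.
Qed.

(** Column [l] has the single nonzero entry 1, in the first row; the minor left is [diag_mx D], and
    the absolute value discards the sign of the cofactor. *)
Lemma norm_det_cond_mx k (l : 'I_k.+1) (c D : 'rV[R]_k) :
  `|\det (cond_mx l c D : 'M[R]_k.+1)| = \prod_j `|D ord0 j|.
Proof.
rewrite (expand_det_col _ l) (bigD1 ord0)//= big1 ?addr0; last first.
  move=> i i0; case: (unliftP ord0 i) i0 => [i' ->|-> /eqP//] _.
  by rewrite cond_mx_lift (negbTE (neq_lift _ _)) !mul0r.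
rewrite cond_mx_ord0 mul1r /cofactor normrM normrX normrN1 expr1n mul1r.
rewrite (_ : row' ord0 (col' l (cond_mx l c D : 'M[R]_k.+1)) = diag_mx D :> 'M[R]_k)
  ?det_diag ?normr_prod//.
apply/matrixP => i j; rewrite mxE [LHS]mxE [RHS]mxE cond_mx_lift.
by rewrite (inj_eq lift_inj) eq_sym; case: eqP => [->|]; rewrite ?mul1r ?mul0r ?mulr0n.
Qed.

(** For unit variances, [cond_coef], [cond_sd] and [cond_corr] are the coefficients of the
    regression on coordinate [l], the standard deviations of the residuals and the correlations of
    the residuals. *)
Definition cond_coef k (S : 'M[R]_k.+1) (l : 'I_k.+1) : 'rV[R]_k :=
  \row_j S (lift l j) l.

Definition cond_sd k (S : 'M[R]_k.+1) (l : 'I_k.+1) : 'rV[R]_k :=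
  \row_j Num.sqrt (1 - S (lift l j) l ^+ 2).

Definition cond_corr k (S : 'M[R]_k.+1) (l : 'I_k.+1) : 'M[R]_k :=
  \matrix_(i, j) ((S (lift l i) (lift l j) - S (lift l i) l * S (lift l j) l)
   / (Num.sqrt (1 - S (lift l i) l ^+ 2) * Num.sqrt (1 - S (lift l j) l ^+ 2))).

Lemma cond_mx_congrE k (l : 'I_k.+1) (c D : 'rV[R]_k) (M : 'M[R]_k) a b :
  ((cond_mx l c D)^T *m block_mx (1%:M : 'M[R]_1) 0 0 M *m cond_mx l c D) a b
  = ins_row l (1, c) ord0 a * ins_row l (1, c) ord0 b
    + (if unlift l a is Some a' then
         if unlift l b is Some b' then D ord0 a' * M a' b' * D ord0 b' else 0
       else 0).
Proof.
rewrite /cond_mx tr_col_mx mul_row_block !mulmx0 addr0 add0r mulmx1.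
rewrite mul_row_col [LHS]mxE; congr (_ + _); first by rewrite mxE big_ord1 mxE.
have sumQ (F : 'I_k -> R) u : \sum_i F i * ((u == lift l i)%:R * D ord0 i)
    = if unlift l u is Some u' then F u' * D ord0 u' else 0.
  case: (unliftP l u) => [u'|] ->.
  - rewrite (bigD1 u')//= eqxx mul1r big1 ?addr0// => i iu'.
    by rewrite (inj_eq lift_inj) eq_sym (negbTE iu') mul0r mulr0.
  - by rewrite big1// => i _; rewrite (negbTE (neq_lift _ _)) mul0r mulr0.
rewrite mxE; under eq_bigr => i _ do rewrite [X in _ * X]mxE.
rewrite sumQ; case: (unlift l b) => [b'|]; last by case: unlift.
rewrite mxE; under eq_bigr => i _ do rewrite mxE [X in X * _]mxE mulrC.
rewrite sumQ; case: (unlift l a) => [a'|]; last by rewrite mul0r.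
by rewrite (mulrC (D _ _)).
Qed.

(** Each covariance splits into the part explained by coordinate [l] and the residual part: [S a b =
    S a l * S b l + D a * M a b * D b], with [D] and [M] the residual deviations and
    correlations. *)
Lemma cond_corrE k (S : 'M[R]_k.+1) (l : 'I_k.+1) :
  S^T = S -> S l l = 1 -> (forall j, cond_sd S l ord0 j != 0) ->
  let E := cond_mx l (cond_coef S l) (cond_sd S l) in
  E^T *m block_mx (1%:M : 'M[R]_1) 0 0 (cond_corr S l) *m E = S.
Proof.
move=> symS Sll D0 E; apply/matrixP => a b; rewrite cond_mx_congrE.
have rE u : ins_row l (1, cond_coef S l) ord0 u = S u l.
  case: (unliftP l u) => [u'|] ->; first by rewrite ins_row_lift mxE.
  by rewrite ins_row_id.
rewrite !rE; case: (unliftP l a) => [a'|] ->; last first.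
  by rewrite Sll mul1r addr0 -[in RHS]symS mxE.
case: (unliftP l b) => [b'|] ->; last by rewrite Sll mulr1 addr0.
have := D0 a'; have := D0 b'; rewrite !mxE => Db Da.
by field; rewrite Da Db.
Qed.

(** Marginal density times conditional density, obtained from the congruence [cond_corrE]. The
    product of the [cond_sd] is the Jacobian of standardizing the residuals. *)
Lemma mvn_pdf_condition k (S : 'M[R]_k.+1) (l : 'I_k.+1) (t : R) (y : 'rV[R]_k) :
  S^T = S -> S \in unitmx -> S l l = 1 -> (forall j, 0 < cond_sd S l ord0 j) ->
  mvn_pdf S (ins_row l (t, y *m diag_mx (cond_sd S l) + t *: cond_coef S l))
    * (\prod_j cond_sd S l ord0 j)
  = normal_pdf 0 1 t * mvn_pdf (cond_corr S l) y.
Proof.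
move=> symS uS Sll D0.
have D0' j : cond_sd S l ord0 j != 0 by rewrite gt_eqF.
set c := cond_coef S l; set D := cond_sd S l.
pose E : 'M[R]_k.+1 := cond_mx l c D.
pose blk : 'M[R]_k.+1 := block_mx (1%:M : 'M[R]_1) 0 0 (cond_corr S l).
have SE : E^T *m blk *m E = S by exact: cond_corrE.
have detE : `|\det E| = \prod_j D ord0 j.
  by rewrite norm_det_cond_mx; apply: eq_bigr => j _; rewrite gtr0_norm.
have uE : E \in unitmx.
  rewrite unitmxE unitfE -normr_eq0 detE; apply/prodf_neq0 => j _; exact: D0'.
have uB : blk \in unitmx.
  by move: uS; rewrite -SE !unitmx_mul => /andP[/andP[_ ->]].
have uM : cond_corr S l \in unitmx.
  have : (block_mx (1%:M : 'M[R]_1) 0 0 (cond_corr S l)) \in unitmx by exact: uB.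
  by rewrite !unitmxE det_ublock det1 mul1r.
rewrite -mul_row_cond_mx -detE -{1}SE (mvn_pdf_congr _ uE uB).
exact: mvn_pdf_block.
Qed.

End gaussian_conditioning.

(** * Positivity of Gram matrices *)

Section gram_matrix.
Context {R : realType}.

Lemma gram_gt0 k (U : 'M[R]_k) (w : 'rV[R]_k) : U \in unitmx -> w != 0 ->
  0 < (w *m (U *m U^T) *m w^T) ord0 ord0.
Proof.
move=> uU w0.
have -> : w *m (U *m U^T) *m w^T = (w *m U) *m (w *m U)^T.
  by rewrite trmx_mul !mulmxA.
have : w *m U != 0 by apply: contra w0 => /eqP wU; rewrite -(mulmxK uU w) wU mul0mx.
move: (w *m U) => u u0; rewrite mxE.
under eq_bigr do rewrite mxE -expr2.
rewrite lt_def sumr_ge0 ?andbT; last by move=> i _; rewrite sqr_ge0.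
apply: contra u0; rewrite psumr_eq0; last by move=> i _; rewrite sqr_ge0.
move=> /allP u0; apply/eqP/rowP => j; rewrite mxE.
by have := u0 j; rewrite mem_index_enum sqrf_eq0 => /(_ isT)/eqP.
Qed.

Lemma delta_row_form k (S : 'M[R]_k) (a b : 'I_k) :
  (delta_mx (ord0 : 'I_1) a *m S *m (delta_mx (ord0 : 'I_1) b)^T) ord0 ord0 = S a b.
Proof.
by rewrite -rowE trmx_delta -colE !mxE.
Qed.

Variables (k : nat) (U : 'M[R]_k).
Hypothesis uU : U \in unitmx.
Let S := U^T *m U.
Let W := invmx S.

Lemma gram_unit : S \in unitmx.
Proof. by rewrite unitmx_mul unitmx_tr uU. Qed.

Lemma gram_sym : S^T = S.
Proof. by rewrite /S trmx_mul trmxK. Qed.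

Lemma gram_inv_sym : W^T = W.
Proof. by rewrite /W trmx_inv gram_sym. Qed.

(** [W] is again a Gram matrix, built from the inverse of [U]. Its entry [W l l] is the leading
    coefficient of the quadratic form in the l-th variable, and has to be positive for completing
    the square. *)
Lemma gram_inv_diag_gt0 l : 0 < W l l.
Proof.
rewrite -delta_row_form.
have -> : W = invmx U *m (invmx U)^T.
  rewrite -[RHS](mulKmx gram_unit) /S trmx_inv -!mulmxA mulKVmx//.
  by rewrite mulmxV ?mulmx1// unitmx_tr.
apply: gram_gt0; first by rewrite unitmx_inv.
by apply/eqP => /rowP/(_ l)/eqP; rewrite !mxE !eqxx oner_eq0.
Qed.

(* [1 - S j l ^+ 2] is the value of the quadratic form S at [e_j - S j l e_l]. *)
Lemma gram_corr_lt1 (l j : 'I_k) : S l l = 1 -> S j j = 1 -> l != j ->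
  0 < 1 - S j l ^+ 2.
Proof.
move=> Sll Sjj lj.
have [s sE] : exists s, s = S j l by exists (S j l).
have sE' : s = S l j by rewrite sE -[in LHS]gram_sym mxE.
pose w : 'rV[R]_k := delta_mx ord0 j - s *: delta_mx ord0 l.
have w0 : w != 0.
  apply/eqP => /rowP/(_ j)/eqP; rewrite !mxE !eqxx/= [_ == l]eq_sym (negbTE lj) mulr0 subr0.
  by rewrite oner_eq0.
have := @gram_gt0 _ U^T w; rewrite unitmx_tr trmxK -/S => /(_ uU w0).
have -> : w^T = (delta_mx ord0 j)^T - s *: (delta_mx ord0 l)^T.
  by rewrite linearB linearZ.
rewrite /w !mulmxBl !mulmxBr -!scalemxAl -!scalemxAr.
have := (delta_row_form S j j, delta_row_form S j l, delta_row_form S l j, delta_row_form S l l).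
rewrite -sE -sE' Sll Sjj.
move: (_ *m (delta_mx _ j)^T) (_ *m (delta_mx _ l)^T).
move: (_ *m (delta_mx _ j)^T) (_ *m (delta_mx _ l)^T) => X1 X2 X3 X4 [[[h1 h2] h3] h4].
rewrite !mxE h1 h2 h3 h4 => w_gt0.
by rewrite (_ : 1 - s ^+ 2 = 1 - s * s - (s * s - s * (s * 1))) //; ring.
Qed.

End gram_matrix.

Section completing_the_square.
Context {R : realType}.
Local Notation mu := (@lebesgue_measure R).

Lemma integral_affine (s c : R) (f : R -> \bar R) : s != 0 ->
  mu.-integrable setT f ->
  (`|s|%:E * \int[mu]_t f (s * t + c)%R = \int[mu]_t f t)%E.
Proof.
move=> s0 fi; have mf := measurable_int _ fi.
have hp := ge0_integral_affine c s0 (measurable_funepos mf) (funepos_ge0 f).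
have hn := ge0_integral_affine c s0 (measurable_funeneg mf) (funeneg_ge0 f).
have si : `|s|%:E != 0%E by rewrite eqe normr_eq0.
have vE (x y : \bar R) : (`|s|%:E * x = y -> x = (`|s|^-1)%:E * y)%E.
  by move=> <-; rewrite muleA -EFinM mulVf ?normr_eq0// mul1e.
rewrite [X in (_ * X)%E]integralE [RHS]integralE.
rewrite funepos_comp funeneg_comp/=.
rewrite (vE _ _ hp) (vE _ _ hn) -muleBr//; last exact: integrable_add_def.
by rewrite muleA -EFinM divff ?normr_eq0// mul1e.
Qed.

Lemma integrable_affine (s c : R) (f : R -> \bar R) : s != 0 ->
  mu.-integrable setT f -> mu.-integrable setT (fun t => f (s * t + c)).
Proof.
move=> s0 /integrableP[mf foo]; apply/integrableP; split.
  apply: (measurableT_comp mf).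
  by apply: measurable_funD => //; exact: mulrl_measurable.
have h := ge0_integral_affine c s0 (measurableT_comp (@abse_measurable _ setT) mf)
  (fun t => abse_ge0 (f t)).
rewrite ltNge leye_eq; apply/eqP => oo; move: h foo => <-.
by rewrite [X in (_ * X)%E]oo gt0_muley ?ltxx// lte_fin normr_gt0.
Qed.

(** [a * t + b] is half the derivative of the quadratic, so the integrand is minus an exact
    derivative; an affine substitution reduces it to [t * phi t]. *)
Lemma integral_gaussian_derivative_ray (a b c kappa : R) (B : \bar R) : 0 < a ->
  (\int[mu]_t (if (B <= t%:E)%E
     then ((a * t + b) * (kappa * expR (- (a * t ^+ 2 + 2 * b * t + c) / 2)))%:E else 0)
   = (if B is r%:E then kappa * expR (- (a * r ^+ 2 + 2 * b * r + c) / 2) else 0)%:E)%E.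
Proof.
(* Then [a t^2 + 2 b t + c = (s t + g)^2 + c - g^2] and [a t + b = s (s t + g)]. The constant [k1]
   below collects the part free of [t] and the normalization of [phi]. *)
move=> a0; pose s := Num.sqrt a; pose g := b / s.
have s0 : 0 < s by rewrite sqrtr_gt0.
have sa : s * s = a by rewrite -expr2 sqr_sqrtr// ltW.
pose k1 := kappa * expR ((g ^+ 2 - c) / 2) * Num.sqrt (2 * pi).
have expE t : kappa * expR (- (a * t ^+ 2 + 2 * b * t + c) / 2) = k1 * normal_pdf 0 1 (s * t + g).
  rewrite std_normal_pdfE /k1 -!mulrA mulVKf ?gt_eqF ?sqrtr_gt0 ?mulr_gt0 ?pi_gt0// -expRD.
  congr (_ * expR _); rewrite -sa (_ : b = s * g) /g; last by rewrite mulrC divfK// gt_eqF.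
  by field; rewrite gt_eqF.
pose B' := (if B is r%:E then (s * r + g)%:E else B)%E.
have BB t : (B' <= (s * t + g)%:E)%E = (B <= t%:E)%E.
  rewrite /B'; case: (B) => [r| |]//; last by rewrite !leNye.
  by rewrite !lee_fin lerD2r ler_pM2l.
pose f t := (if (B' <= t%:E)%E then (t * normal_pdf 0 1 t)%:E else 0)%E.
have fi : mu.-integrable setT f.
  apply: (@le_integrable _ _ _ mu setT measurableT f
    (EFin \o (fun t => t * normal_pdf 0 1 t))).
  - apply: measurable_fun_ifT => //; first exact: measurable_fun_lee.
    apply/measurable_EFinP/measurable_funM => //; exact: measurable_normal_pdf.
  - by move=> t _; rewrite /f; case: ifP => // _; rewrite abse0.
  - exact: integrable_dominated_std_normal_pdf norm_le1_sqr.
have := integral_affine g (lt0r_neq0 s0) fi.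
rewrite {2}/f integral_id_std_normal_pdf_ray gtr0_norm// => E.
transitivity ((k1 * s)%:E * \int[mu]_t f (s * t + g)%R)%E; last first.
  rewrite EFinM -muleA E -EFinM /B'; congr EFin.
  by case: (B) => [r| |]; rewrite /= ?mulr0// expE.
rewrite -integralZl//; last exact: integrable_affine (lt0r_neq0 s0) fi.
apply: eq_integral => t _; rewrite /f BB; case: ifP => _; last by rewrite mule0.
rewrite -EFinM expE; congr EFin; rewrite -sa.
by rewrite (_ : b = s * g) /g; [ring|rewrite mulrC divfK// gt_eqF].
Qed.

End completing_the_square.

(** * Tallis' formula on an orthant *)

Section orthant_moments.
Context {R : realType}.
Local Notation stdn := (@normal_prob R 0 1).

Definition row_ge k (B : 'rV[\bar R]_k) (z : 'rV[R]_k) : bool :=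
  [forall l, (B ord0 l <= (z ord0 l)%:E)%E].

Lemma measurable_forall_ord d (T : measurableType d) k (P : 'I_k -> T -> bool) :
  (forall l, measurable_fun setT (P l)) -> measurable_fun setT (fun z => [forall l, P l z]).
Proof.
move=> mP; apply: (measurable_fun_bool true).
rewrite setTI (_ : _ @^-1` _ = \big[setI/setT]_(l < k) (P l @^-1` [set true])).
  apply: bigsetI_measurable => l _.
  by rewrite -[X in measurable X]setTI; exact: mP.
rewrite -bigcap_seq; apply/seteqP; split => z /=.
- by move=> /forallP Pz l _; exact: Pz.
- by move=> Pz; apply/forallP => l; apply: Pz; rewrite /= mem_index_enum.
Qed.

Lemma measurable_row_ge k (B : 'rV[\bar R]_k) : measurable_fun setT (row_ge B).
Proof.
apply: measurable_forall_ord => l.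
apply: measurable_fun_lee => //; apply/measurable_EFinP; exact: measurable_coord.
Qed.

Lemma row_ge_ins k (l : 'I_k.+1) (B : 'rV[\bar R]_k.+1) t v :
  row_ge B (ins_row l (t, v))
  = (B ord0 l <= t%:E)%E && row_ge (\row_j B ord0 (lift l j)) v.
Proof.
apply/forallP/andP => [Bz|[Bt /forallP Bv] j].
- split; first by have := Bz l; rewrite ins_row_id.
  by apply/forallP => j; have := Bz (lift l j); rewrite ins_row_lift mxE.
- case: (unliftP l j) => [j'|] ->; rewrite ?ins_row_lift ?ins_row_id//.
  by have := Bv j'; rewrite mxE.
Qed.

Lemma measurable_restrict_row_ge k (B : 'rV[\bar R]_k) (f : 'rV[R]_k -> \bar R) :
  measurable_fun setT f ->
  measurable_fun setT (fun z => if row_ge B z then f z else 0%E).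
Proof. by move=> mf; apply: measurable_fun_ifT => //; exact: measurable_row_ge. Qed.

Lemma integrable_restrict_row_ge k (B : 'rV[\bar R]_k) (f : 'rV[R]_k -> \bar R) :
  (lebn k).-integrable setT f ->
  (lebn k).-integrable setT (fun z => if row_ge B z then f z else 0%E).
Proof.
move=> fi; apply: (le_integrable measurableT _ _ fi).
  by apply: measurable_restrict_row_ge; exact: measurable_int fi.
by move=> z _; case: ifP => // _; rewrite abse0.
Qed.

(** The reflection [- 1%:M] is triangular with Jacobian 1, and the density is even. *)
Lemma mvn_cdf_opp k (B : 'rV[\bar R]_k) (S : 'M[R]_k) :
  mvn_cdf (opp_vec B) S
  = fine (\int[lebn k]_z (if row_ge B z then (mvn_pdf S z)%:E else 0))%E.
Proof.
pose f (z : 'rV[R]_k) := (if row_ge B z then (mvn_pdf S z)%:E else 0)%E.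
have mf : measurable_fun setT f.
  by apply: measurable_restrict_row_ge; apply/measurable_EFinP; exact: measurable_mvn_pdf.
have f0 z : (0 <= f z)%E by rewrite /f; case: ifP => // _; rewrite lee_fin mvn_pdf_ge0.
have fE z : f (z *m (- 1%:M) + 0)
    = (if [forall l, ((z ord0 l)%:E <= opp_vec B ord0 l)%E] then (mvn_pdf S z)%:E else 0)%E.
  rewrite addr0 mulmxN mulmx1 /f mvn_pdfN; congr (if _ then _ else _).
  by apply: eq_forallb => l; rewrite !mxE leeNr.
pose g (z : 'rV[R]_k) := f (z *m (- 1%:M) + 0).
have mg : measurable_fun setT g.
  by apply: (measurableT_comp mf); exact: measurable_row_affine.
have g0 z : (0 <= g z)%E by exact: f0.
rewrite /mvn_cdf; congr fine; transitivity (integral_rV g).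
  by congr integral_rV; apply/funext => z; rewrite /g fE.
rewrite (integral_rVE mg g0).
rewrite -(ge0_integral_triangular (U := - 1%:M) 0 _ _ mf f0).
- by rewrite big1 ?mul1e// => i _; rewrite !mxE eqxx normrN normr1.
- by move=> i j ij; rewrite !mxE -val_eqE/= gtn_eqF// oppr0.
- by move=> i; rewrite !mxE eqxx oppr_eq0 oner_eq0.
Qed.

(** The bounds on the standardized residuals when coordinate [l] equals [t]; at [t] equal to the
    l-th bound they have the form of the [alpha] of the statement. *)
Definition cond_bound k (S : 'M[R]_k.+1) (B : 'rV[\bar R]_k.+1) (l : 'I_k.+1) (t : R)
    : 'rV[\bar R]_k :=
  \row_j ((B ord0 (lift l j) - (S (lift l j) l)%:E * t%:E)
    * ((Num.sqrt (1 - S (lift l j) l ^+ 2))^-1)%:E)%E.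

Lemma row_ge_cond_bound k (S : 'M[R]_k.+1) (B : 'rV[\bar R]_k.+1) (l : 'I_k.+1) t y :
  (forall j, 0 < cond_sd S l ord0 j) ->
  row_ge (\row_j B ord0 (lift l j)) (y *m diag_mx (cond_sd S l) + t *: cond_coef S l)
  = row_ge (cond_bound S B l t) y.
Proof.
move=> D0; apply: eq_forallb => j; have := D0 j.
rewrite !mxE (bigD1 j)//= big1 ?addr0; last first.
  by move=> i ij; rewrite !mxE (negbTE ij) mulr0n mulr0.
rewrite !mxE eqxx mulr1n (mulrC t); move: (Num.sqrt _) => s s0.
case: (B ord0 (lift l j)) => [r| |].
- by rewrite !lee_fin ler_pdivrMr// lerBlDr.
- by rewrite [X in (X * _)%E]addye// gt0_mulye ?lte_fin ?invr_gt0.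
- by rewrite addNye gt0_mulNye ?lte_fin ?invr_gt0// !leNye.
Qed.

Lemma integral_orthant_condition k (S : 'M[R]_k.+1) (B : 'rV[\bar R]_k.+1) (l : 'I_k.+1) t :
  S^T = S -> S \in unitmx -> S l l = 1 -> (forall j, 0 < cond_sd S l ord0 j) ->
  (\int[lebn k]_v (if row_ge (\row_j B ord0 (lift l j)) v
      then (mvn_pdf S (ins_row l (t, v)))%:E else 0)
   = (normal_pdf 0 1 t)%:E * \int[lebn k]_y (if row_ge (cond_bound S B l t) y
      then (mvn_pdf (cond_corr S l) y)%:E else 0))%E.
Proof.
move=> symS uS Sll D0.
have mpdf (M : 'M[R]_k) : measurable_fun setT (fun y => (mvn_pdf M y)%:E).
  by apply/measurable_EFinP; exact: measurable_mvn_pdf.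
have mins : measurable_fun setT (fun v => (mvn_pdf S (ins_row l (t, v)))%:E).
  apply/measurable_EFinP; apply: (measurableT_comp (measurable_mvn_pdf S)).
  exact: measurableT_comp (measurable_ins_row l) (pair1_measurable t).
rewrite -(ge0_integral_triangular (U := diag_mx (cond_sd S l)) (t *: cond_coef S l)); last 4 first.
- by move=> i j ij; rewrite !mxE -val_eqE/= gtn_eqF// mulr0n.
- by move=> i; rewrite mxE eqxx mulr1n gt_eqF.
- exact: measurable_restrict_row_ge.
- by move=> z; case: ifP => // _; rewrite lee_fin mvn_pdf_ge0.
rewrite -[RHS]ge0_integralZl_EFin//; last 3 first.
- by move=> z _; case: ifP => // _; rewrite lee_fin mvn_pdf_ge0.
- exact: measurable_restrict_row_ge.
- exact: normal_pdf_ge0.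
rewrite -[LHS]ge0_integralZl_EFin//; last 3 first.
- by move=> z _; case: ifP => // _; rewrite lee_fin mvn_pdf_ge0.
- apply: (measurableT_comp (measurable_restrict_row_ge _ mins)).
  exact: measurable_row_affine.
- exact: prodr_ge0.
apply: eq_integral => y _; rewrite row_ge_cond_bound//; case: ifP; rewrite ?mule0// => _.
rewrite -!EFinM -mvn_pdf_condition// mulrC; congr (_ * _)%:E.
by apply: eq_bigr => j _; rewrite mxE eqxx mulr1n gtr0_norm.
Qed.

Lemma ins_row_add k (l : 'I_k.+1) (t : R) (v : 'rV[R]_k) :
  ins_row l (t, v) = ins_row l (0, v) + t *: delta_mx ord0 l.
Proof.
apply/rowP => j; rewrite !mxE eqxx/=; case: unliftP => [j'|] ->.
- by rewrite [lift l j' == l]eq_sym (negbTE (neq_lift _ _)) mulr0 addr0.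
- by rewrite eqxx mulr1 add0r.
Qed.

Lemma mulmx_ins_row k (W : 'M[R]_k.+1) (l : 'I_k.+1) (t : R) (v : 'rV[R]_k) :
  (ins_row l (t, v) *m W) ord0 l = W l l * t + (ins_row l (0, v) *m W) ord0 l.
Proof.
by rewrite ins_row_add mulmxDl -scalemxAl -rowE [LHS]mxE [X in _ + X]mxE [X in _ * X]mxE addrC mulrC.
Qed.

Lemma form_ins_row k (W : 'M[R]_k.+1) (l : 'I_k.+1) (t : R) (v : 'rV[R]_k) : W^T = W ->
  (ins_row l (t, v) *m W *m (ins_row l (t, v))^T) ord0 ord0
  = W l l * t ^+ 2 + 2 * (ins_row l (0, v) *m W) ord0 l * t
    + (ins_row l (0, v) *m W *m (ins_row l (0, v))^T) ord0 ord0.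
Proof.
move=> symW; rewrite ins_row_add; set z := ins_row l (0, v).
set e : 'rV[R]_k.+1 := delta_mx ord0 l.
have eW : (z *m W *m e^T) ord0 ord0 = (z *m W) ord0 l.
  by rewrite /e trmx_delta -colE mxE.
have We : (e *m W *m z^T) ord0 ord0 = (z *m W) ord0 l.
  rewrite -eW (_ : (z *m W *m e^T) ord0 ord0 = (z *m W *m e^T)^T ord0 ord0); last by rewrite [RHS]mxE.
  by rewrite !trmx_mul trmxK symW mulmxA.
have ee : (e *m W *m e^T) ord0 ord0 = W l l by exact: delta_row_form.
have -> : (z + t *: e)^T = z^T + t *: e^T by rewrite linearD linearZ.
rewrite !mulmxDl !mulmxDr -!scalemxAl -!scalemxAr.
move: eW We ee; move: (z *m W *m e^T) (e *m W *m z^T) (e *m W *m e^T) (z *m W *m z^T).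
move=> X1 X2 X3 X4; move: ((z *m W) ord0 l) (W l l) => b a h1 h2 h3.
by rewrite !mxE h1 h2 h3; ring.
Qed.

(** With the other coordinates [v] fixed, the exponent is a quadratic in [t] with leading
    coefficient [W l l], and the l-th entry of [z *m W] is half its derivative; the inner integral
    is thus a boundary value on the face. *)
Lemma integral_orthant_score k (U : 'M[R]_k.+1) (B : 'rV[\bar R]_k.+1) (l : 'I_k.+1) :
  let S := U^T *m U in U \in unitmx ->
  (lebn k.+1).-integrable setT (fun z => ((z *m invmx S) ord0 l * mvn_pdf S z)%:E) ->
  (\int[lebn k.+1]_z (if row_ge B z then ((z *m invmx S) ord0 l * mvn_pdf S z)%:E else 0)
   = if B ord0 l is r%:E then
       \int[lebn k]_v (if row_ge (\row_j B ord0 (lift l j)) v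
         then (mvn_pdf S (ins_row l (r, v)))%:E else 0)
     else 0)%E.
Proof.
move=> S uU fi; set W := invmx S.
pose Bl := (\row_j B ord0 (lift l j)).
rewrite (integral_ins2 l); last exact: integrable_restrict_row_ge.
transitivity (\int[lebn k]_v (if row_ge Bl v then
   (if B ord0 l is r%:E then mvn_pdf S (ins_row l (r, v)) else 0)%:E else 0))%E; last first.
  by case: (B ord0 l) => [r| |] //; apply: integral0_eq => v _; case: ifP.
apply: eq_integral => v _.
under eq_integral do rewrite row_ge_ins -/Bl.
case: ifP => _; last by apply: integral0_eq => t _; rewrite andbF.
pose kappa := (Num.sqrt ((2 * pi) ^+ k.+1 * \det S))^-1.
pose b := (ins_row l (0, v) *m W) ord0 l.
pose c := (ins_row l (0, v) *m W *m (ins_row l (0, v))^T) ord0 ord0.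
have pdfE t : mvn_pdf S (ins_row l (t, v))
    = kappa * expR (- (W l l * t ^+ 2 + 2 * b * t + c) / 2).
  by rewrite /mvn_pdf form_ins_row ?gram_inv_sym// mulrC.
have := integral_gaussian_derivative_ray b c kappa (B ord0 l) (gram_inv_diag_gt0 uU l).
rewrite -/S -/W => E; transitivity
  (if B ord0 l is r%:E
   then kappa * expR (- (W l l * r ^+ 2 + 2 * b * r + c) / 2) else 0)%:E.
  rewrite -E; apply: eq_integral => t _.
  by rewrite andbT; case: ifP => // _; rewrite mulmx_ins_row pdfE.
by case: (B ord0 l) => [r| |] //; rewrite pdfE.
Qed.

Lemma triangular_unitmx k (U : 'M[R]_k) :
  (forall i j : 'I_k, (j < i)%N -> U i j = 0) -> (forall i, U i i != 0) -> U \in unitmx.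
Proof.
move=> tU dU; rewrite unitmxE -det_tr det_trig; last first.
  by apply/is_trig_mxP => i j ij; rewrite mxE tU.
by rewrite unitfE; apply/prodf_neq0 => i _; rewrite mxE.
Qed.

Lemma integrable_coord_mvn_pdf k (U : 'M[R]_k) (i : 'I_k) :
  (forall i j : 'I_k, (j < i)%N -> U i j = 0) -> (forall i, U i i != 0) ->
  (lebn k).-integrable setT (fun z => (z ord0 i * mvn_pdf (U^T *m U) z)%:E).
Proof.
move=> tU dU; under eq_fun do rewrite EFinM.
apply: (@integrable_lebn_mvn _ _ U (fun z => (z ord0 i)%:E)) => //.
  by apply/measurable_EFinP; exact: measurable_coord.
exact: integrable_powm_mulmx.
Qed.

Lemma integrable_mulmx_mvn_pdf k (U W : 'M[R]_k) (l : 'I_k) :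
  (forall i j : 'I_k, (j < i)%N -> U i j = 0) -> (forall i, U i i != 0) ->
  (lebn k).-integrable setT (fun z => ((z *m W) ord0 l * mvn_pdf (U^T *m U) z)%:E).
Proof.
move=> tU dU; under eq_fun do rewrite mxE big_distrl/= -sumEFin.
apply: integrable_sum => //= j _; under eq_fun do rewrite mulrAC mulrC EFinM.
by apply: integrableZl => //; exact: integrable_coord_mvn_pdf.
Qed.

(** The equation for [A] is asked at a finite bound only: at an infinite one [std_normal_pdf]
    already makes the term 0, and the expression for [A] would depend on conventions for
    infinities. *)
Lemma integral_orthant_score_mvn_cdf k (U : 'M[R]_k.+1) (B : 'rV[\bar R]_k.+1) (l : 'I_k.+1)
    (A : 'rV[\bar R]_k) :
  let S := U^T *m U in
  (forall i j : 'I_k.+1, (j < i)%N -> U i j = 0) -> (forall i, U i i != 0) ->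
  (forall i, S i i = 1) ->
  (forall j, B ord0 l \is a fin_num ->
    A ord0 j = (B ord0 (lift l j) - (S (lift l j) l)%:E * B ord0 l)
    * ((Num.sqrt (1 - S (lift l j) l ^+ 2))^-1)%:E)%E ->
  (\int[lebn k.+1]_z (if row_ge B z then ((z *m invmx S) ord0 l * mvn_pdf S z)%:E else 0)
   = (std_normal_pdf (B ord0 l) * mvn_cdf (opp_vec A) (cond_corr S l))%:E)%E.
Proof.
move=> S tU dU S1 AE; have uU := triangular_unitmx tU dU.
have fi : (lebn k.+1).-integrable setT (fun z => ((z *m invmx S) ord0 l * mvn_pdf S z)%:E).
  exact: integrable_mulmx_mvn_pdf.
have D0 j : 0 < cond_sd S l ord0 j.
  by rewrite mxE sqrtr_gt0 gram_corr_lt1// neq_lift.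
have := integral_orthant_score B uU fi.
(* [mvn_cdf] is defined through [fine], so the integral over the face must be known to be finite.
   Its product with a positive density is the integral of the score, which is finite by
   integrability. *)
have := integrable_fin_num measurableT (integrable_restrict_row_ge B fi).
case BE : (B ord0 l) => [r| |] fin E; rewrite E /= ?mul0r//.
move: fin; rewrite E integral_orthant_condition ?gram_sym ?gram_unit// => fin.
rewrite EFinM mvn_cdf_opp; congr (_ * _)%E.
have -> : A = cond_bound S B l r by apply/rowP => j; rewrite AE BE// [RHS]mxE.
rewrite fineK//.
move: fin; set I := (\int[_]_y _)%E => fin.
have p0 : 0 < normal_pdf 0 1 r :> R.
  by rewrite std_normal_pdfE mulr_gt0 ?expR_gt0 ?invr_gt0 ?sqrtr_gt0 ?mulr_gt0 ?pi_gt0.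
case: I fin => // [|].
- by rewrite gt0_muley ?lte_fin.
- by rewrite gt0_muleNy ?lte_fin.
Qed.

(** [A] and [M] enter through equations, so that the vectors with and without hats can both be
    plugged in as they are defined. *)
Lemma integral_orthant_coord k (U : 'M[R]_k) (B : 'rV[\bar R]_k)
    (A : 'I_k -> 'rV[\bar R]_k.-1) (M : 'I_k -> 'M[R]_k.-1) (i : 'I_k) :
  let S := U^T *m U in
  (forall i j : 'I_k, (j < i)%N -> U i j = 0) -> (forall i, U i i != 0) ->
  (forall i, S i i = 1) ->
  (forall l j, B ord0 l \is a fin_num ->
    A l ord0 j = (B ord0 (lift l j) - (S (lift l j) l)%:E * B ord0 l)
    * ((Num.sqrt (1 - S (lift l j) l ^+ 2))^-1)%:E)%E ->
  (forall l j m, M l j m = (S (lift l j) (lift l m) - S (lift l j) l * S (lift l m) l)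
    / (Num.sqrt (1 - S (lift l j) l ^+ 2) * Num.sqrt (1 - S (lift l m) l ^+ 2))) ->
  (\int[lebn k]_z (if row_ge B z then (z ord0 i * mvn_pdf S z)%:E else 0)
   = (\sum_l S i l * std_normal_pdf (B ord0 l) * mvn_cdf (opp_vec (A l)) (M l))%:E)%E.
Proof.
case: k U B A M i => [|k] U B A M i; first by case: i.
move=> S tU dU S1 AE ME; have uU := triangular_unitmx tU dU.
have uS := gram_unit uU.
have symS a b : S a b = S b a.
  by have /matrixP/(_ b a) := gram_sym U; rewrite [LHS]mxE.
transitivity (\int[lebn k.+1]_z (\sum_l (S i l)%:E *
   (if row_ge B z then ((z *m invmx S) ord0 l * mvn_pdf S z)%:E else 0)))%E.
  apply: eq_integral => z _; case: ifP => _; last by rewrite big1// => l _; rewrite mule0.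
  under eq_bigr do rewrite -EFinM mulrA; rewrite sumEFin -big_distrl/=.
  congr (_ * _)%:E; rewrite -{1}(mulmxKV uS z) mxE; apply: eq_bigr => l _.
  by rewrite mulrC symS.
have fi l := integrable_restrict_row_ge B (integrable_mulmx_mvn_pdf (invmx S) l tU dU).
rewrite integral_sum//; last by move=> l; exact: integrableZl.
rewrite -sumEFin; apply: eq_bigr => l _; rewrite integralZl//.
rewrite -mulrA EFinM; congr (_ * _)%E.
have -> : M l = cond_corr S l by apply/matrixP => a b; rewrite ME [RHS]mxE.
apply: integral_orthant_score_mvn_cdf => // j Bl; exact: AE.
Qed.

End orthant_moments.

Section gaussian_vector.
Context d (Omega : measurableType d) (R : realType) (P : probability Omega R).
Local Notation stdn := (@normal_prob R 0 1).

(** Crossing means reaching the threshold or falling below it, so not having crossed is a strict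
    inequality. *)
Definition row_gt k (B : 'rV[\bar R]_k) (z : 'rV[R]_k) : bool :=
  [forall l, (B ord0 l < (z ord0 l)%:E)%E].

Lemma measurable_row_gt k (B : 'rV[\bar R]_k) : measurable_fun setT (row_gt B).
Proof.
apply: measurable_forall_ord => l.
apply: measurable_fun_lte => //; apply/measurable_EFinP; exact: measurable_coord.
Qed.

Lemma lebn_hyperplane k (l : 'I_k) (r : R) :
  (lebn k).-negligible [set z | z ord0 l = r].
Proof.
pose A (j : 'I_k) : set R := if j == l then [set r] else setT.
have mA j : measurable (A j) by rewrite /A; case: eqP.
apply: (@negligibleS _ _ _ _ (box A)).
  by move=> z /= zl j; rewrite /A; case: eqP => [->|].
apply/negligibleP; first exact: measurable_box.
apply: etrans (powm_box _ mA) _.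
by rewrite (bigD1 l)//= /A eqxx lebesgue_measure_set1 mul0e.
Qed.

Lemma ae_row_gt_row_ge k (B : 'rV[\bar R]_k) :
  {ae lebn k, forall z, row_gt B z = row_ge B z}.
Proof.
(* At an infinite entry [fine] returns 0; one more null hyperplane is then excluded, harmlessly. *)
have : {ae lebn k, forall z : 'rV[R]_k, forall l, z ord0 l != fine (B ord0 l)}.
  apply: filter_forall => l; apply: negligibleS (lebn_hyperplane l (fine (B ord0 l))).
  by move=> z /= /negP; rewrite negbK => /eqP.
apply: filterS => z zB; apply: eq_forallb => l.
move: (zB l); rewrite lt_neqAle; case: (B ord0 l) => [r| |] //= zr.
by rewrite eqe eq_sym zr.
Qed.

Variables (k : nat) (X : 'I_k -> Omega -> R) (U : 'M[R]_k).
Hypothesis mX : forall i, measurable_fun setT (X i).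
Hypothesis lawX : forall A : 'I_k -> set R, (forall i, measurable (A i)) ->
  P (\bigcap_(i in setT) (X i @^-1` A i)) = (\prod_(i < k) stdn (A i))%E.
Hypothesis tU : forall i j : 'I_k, (j < i)%N -> U i j = 0.
Hypothesis dU : forall i, U i i != 0.

Let Z w : 'rV[R]_k := (\row_i X i w) *m U.
Let S := U^T *m U.

Lemma measurable_gaussian_vector : measurable_fun setT Z.
Proof.
have := measurable_row_affine U 0; under eq_fun do rewrite addr0.
move=> /measurableT_comp; apply; apply: measurable_fun_row => i.
by under eq_fun do rewrite mxE; exact: mX.
Qed.

Lemma integral_gaussian_vector (f : 'rV[R]_k -> \bar R) : measurable_fun setT f ->
  (\int[P]_w f (Z w) = \int[lebn k]_z (f z * (mvn_pdf S z)%:E))%E.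
Proof.
move=> mf; rewrite -integral_mvn// -(powm_law_signed mX lawX (f := fun v => f (v *m U)))//.
have := measurable_row_affine U 0; under eq_fun do rewrite addr0.
exact: measurableT_comp.
Qed.

Lemma integrable_gaussian_coord i : P.-integrable setT (fun w => (Z w ord0 i)%:E).
Proof.
have mz : measurable_fun setT (fun z : 'rV[R]_k => `|(z ord0 i)%:E|)%E.
  by apply: measurableT_comp => //; apply/measurable_EFinP; exact: measurable_coord.
apply/integrableP; split.
  apply/measurable_EFinP; exact: (measurableT_comp (measurable_coord i) measurable_gaussian_vector).
rewrite (integral_gaussian_vector mz).
have /integrableP[_] := integrable_coord_mvn_pdf i tU dU.
apply: le_lt_trans; rewrite le_eqVlt; apply/orP; left; apply/eqP.
by apply: eq_integral => z _; rewrite /= normrM EFinM (ger0_norm (mvn_pdf_ge0 _ _)).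
Qed.

Lemma integral_gaussian_mul i j :
  (\int[P]_w (Z w ord0 i * Z w ord0 j)%:E = (S i j)%:E)%E.
Proof.
rewrite -integral_powm_mulmx_mul.
rewrite -(powm_law_signed mX lawX (f := fun v => ((v *m U) ord0 i * (v *m U) ord0 j)%:E))//.
have mUc l : measurable_fun setT (fun v : 'rV[R]_k => (v *m U) ord0 l).
  have := measurable_row_affine U 0; under eq_fun do rewrite addr0.
  by move=> /(measurableT_comp (measurable_coord l)).
by apply/measurable_EFinP; exact: measurable_funM.
Qed.

Lemma integral_gaussian_coord i : (\int[P]_w (Z w ord0 i)%:E = 0)%E.
Proof.
have mz : measurable_fun setT (fun z : 'rV[R]_k => (z ord0 i)%:E)%E.
  by apply/measurable_EFinP; exact: measurable_coord.
rewrite (integral_gaussian_vector mz) -integral_mvn//.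
under eq_integral do rewrite mxE -sumEFin.
have fi j : (powm stdn k).-integrable setT (fun v => (U j i)%:E * (v ord0 j)%:E)%E.
  by apply: integrableZl => //; exact: integrable_powm_coord.
rewrite integral_sum//=; last by move=> j; under eq_fun do rewrite mulrC EFinM; exact: fi.
rewrite big1// => j _; under eq_integral do rewrite mulrC EFinM.
rewrite integralZl//; last exact: integrable_powm_coord.
by rewrite integral_powm_coord mule0.
Qed.

Lemma covariance_gaussian i j :
  covariance P (fun w => Z w ord0 i) (fun w => Z w ord0 j) = (S i j)%:E.
Proof.
rewrite unlock.
have E0 l : ('E_P[fun w => Z w ord0 l] = 0)%E.
  by rewrite unlock integral_gaussian_coord.
rewrite !E0 unlock -integral_gaussian_mul; apply: eq_integral => w _.
by rewrite -[LHS]/(((Z w ord0 i - 0) * (Z w ord0 j - 0))%:E) !subr0.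
Qed.

Lemma probability_orthant (B : 'rV[\bar R]_k) :
  P [set w | row_gt B (Z w)] = (mvn_cdf (opp_vec B) S)%:E.
Proof.
have mB : measurable_fun setT (fun z : 'rV[R]_k => if row_gt B z then 1 else 0 : \bar R)%E.
  by apply: measurable_fun_ifT => //; exact: measurable_row_gt.
have mBZ : measurable [set w | row_gt B (Z w)].
  rewrite -[X in measurable X]setTI.
  exact: (measurableT_comp (measurable_row_gt B) measurable_gaussian_vector) measurableT [set true] _.
have E : (P [set w | row_gt B (Z w)]
    = \int[lebn k]_z (if row_ge B z then (mvn_pdf S z)%:E else 0))%E.
  rewrite -[LHS]mul1e -integral_cst// integral_mkcond.
  transitivity (\int[P]_w (if row_gt B (Z w) then 1 else 0))%E.
    by apply: eq_integral => w _; rewrite patchE mem_setE.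
  rewrite (integral_gaussian_vector mB); apply: ae_eq_integral => //.
  - apply: emeasurable_funM => //; apply/measurable_EFinP; exact: measurable_mvn_pdf.
  - by apply: measurable_restrict_row_ge; apply/measurable_EFinP; exact: measurable_mvn_pdf.
  - have := ae_row_gt_row_ge B; apply: filterS => z -> _.
    by case: ifP; rewrite ?mul1e ?mul0e.
by rewrite mvn_cdf_opp -E fineK// fin_num_measure.
Qed.

Lemma integral_orthant_gaussian (B : 'rV[\bar R]_k)
    (A : 'I_k -> 'rV[\bar R]_k.-1) (M : 'I_k -> 'M[R]_k.-1) (i : 'I_k) :
  (forall i, S i i = 1) ->
  (forall l j, B ord0 l \is a fin_num ->
    A l ord0 j = (B ord0 (lift l j) - (S (lift l j) l)%:E * B ord0 l)
    * ((Num.sqrt (1 - S (lift l j) l ^+ 2))^-1)%:E)%E ->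
  (forall l j m, M l j m = (S (lift l j) (lift l m) - S (lift l j) l * S (lift l m) l)
    / (Num.sqrt (1 - S (lift l j) l ^+ 2) * Num.sqrt (1 - S (lift l m) l ^+ 2))) ->
  (\int[P]_(w in [set w | row_gt B (Z w)]) (Z w ord0 i)%:E
   = (\sum_l S i l * std_normal_pdf (B ord0 l) * mvn_cdf (opp_vec (A l)) (M l))%:E)%E.
Proof.
move=> S1 AE ME.
rewrite -(integral_orthant_coord i tU dU S1 AE ME).
pose f (z : 'rV[R]_k) := (if row_gt B z then (z ord0 i)%:E else 0)%E.
have mz : measurable_fun setT (fun z : 'rV[R]_k => (z ord0 i)%:E).
  by apply/measurable_EFinP; exact: measurable_coord.
have mf : measurable_fun setT f.
  by apply: measurable_fun_ifT => //; exact: measurable_row_gt.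
rewrite integral_mkcond; transitivity (\int[P]_w f (Z w))%E.
  by apply: eq_integral => w _; rewrite patchE mem_setE.
have mpdf : measurable_fun setT (fun z => (mvn_pdf S z)%:E).
  by apply/measurable_EFinP; exact: measurable_mvn_pdf.
rewrite (integral_gaussian_vector mf); apply: ae_eq_integral => //.
- exact: emeasurable_funM.
- apply: measurable_restrict_row_ge; under eq_fun do rewrite EFinM.
  exact: emeasurable_funM.
- have := ae_row_gt_row_ge B; apply: filterS => z zB _.
  by rewrite /f zB; case: ifP; rewrite ?mul0e// EFinM.
Qed.

End gaussian_vector.

(** * The price model *)

Section shock_law.
Context {R : realType}.

Lemma normal_prob_scale (s : R) (A : set R) : 0 < s -> measurable A ->
  normal_prob 0 s ((fun t => t / s) @^-1` A) = normal_prob 0 1 A.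
Proof.
move=> s0 mA; rewrite /normal_prob integral_mkcond [RHS]integral_mkcond.
set f := (_ \_ A).
have f0 t : (0 <= f t)%E.
  by rewrite /f patchE; case: ifP => // _; rewrite lee_fin normal_pdf_ge0.
have mf : measurable_fun setT f.
  apply/(measurable_restrictT _ mA); apply: measurable_funTS.
  by apply/measurable_EFinP; exact: measurable_normal_pdf.
have mfs : measurable_fun setT (fun t : R => f (s^-1 * t + 0)).
  by apply: (measurableT_comp mf); apply: measurable_funD => //; exact: mulrl_measurable.
rewrite -(ge0_integral_affine 0 (invr_neq0 (lt0r_neq0 s0)) mf f0).
rewrite -ge0_integralZl_EFin//; apply: eq_integral => t _.
rewrite addr0 /f !patchE [s^-1 * t]mulrC.
rewrite (_ : (t \in _) = (t / s \in A)); last by apply/idP/idP => /set_mem ?; exact/mem_set.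
case: ifP => _; last by rewrite mule0.
rewrite -EFinM gtr0_norm ?invr_gt0//; congr EFin.
rewrite std_normal_pdfE normal_pdfE ?gt_eqF// /normal_peak /normal_fun subr0.
rewrite -mulrnAr sqrtrM ?sqr_ge0// sqrtr_sqr gtr0_norm// invfM -!mulrA.
rewrite [2 * pi]mulr_natl; congr (_ * (_ * expR _)).
by field; rewrite gt_eqF.
Qed.

Lemma shock_vector_law d (Omega : measurableType d) (P : probability Omega R)
    (I : pred nat) (eps : nat -> {RV P >-> R}) (s : R) (n k : nat) : 0 < s ->
  mutually_independent I eps ->
  (forall j, I j -> forall A : set R, measurable A ->
     distribution P (eps j) A = normal_prob 0 s A) ->
  (forall r : 'I_k, I (n.+1 + r)%N) ->
  forall A : 'I_k -> set R, (forall r, measurable (A r)) ->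
  P (\bigcap_(r in [set: 'I_k]) ((fun w => eps (n.+1 + r)%N w / s) @^-1` A r))
  = (\prod_(r < k) normal_prob 0 1 (A r))%E.
Proof.
move=> s0 ind law Ik A mA.
(* Independence is stated for sets indexed by [nat]. By truncated subtraction an index [j <= n] may
   receive the first set, which is harmless: [J] contains only indices [n.+1 + r]. *)
pose A' j : set R := if (insub (j - n.+1)%N : option 'I_k) is Some r then (fun t => t / s) @^-1` A r else setT.
have A'E (r : 'I_k) : A' (n.+1 + r)%N = (fun t => t / s) @^-1` A r.
  by rewrite /A' addKn valK.
have mdiv (B : set R) : measurable B -> measurable ((fun t : R => t / s) @^-1` B).
  move=> mB; rewrite -[X in measurable X]setTI.
  by apply: (measurable_funM (@measurable_id _ _ setT) (measurable_cst s^-1)).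
have mA' j : measurable (A' j).
  by rewrite /A'; case: insub => [r|//]; exact: mdiv.
pose J := [seq (n.+1 + nat_of_ord r)%N | r <- index_enum 'I_k].
have uJ : uniq J.
  by rewrite map_inj_uniq ?index_enum_uniq// => r r' /addnI/val_inj.
have JI : {subset J <= I} by move=> _ /mapP[r _ ->]; exact: Ik.
have := ind J A' uJ JI mA'; rewrite /J !big_map => indJ.
transitivity (P (\big[setI/setT]_(r <- index_enum 'I_k) (eps (n.+1 + r)%N @^-1` A' (n.+1 + r)%N))).
  congr (P _); rewrite -bigcap_seq; apply/seteqP; split => w /= Aw r.
  - by move=> _; rewrite A'E; exact: Aw.
  - by move=> _; have := Aw r; rewrite A'E; apply; rewrite /= mem_index_enum.
rewrite indJ; apply: eq_bigr => r _; rewrite A'E -(normal_prob_scale s0 (mA r)).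
by rewrite -(law (n.+1 + r)%N (Ik r))//; exact: mdiv.
Qed.

End shock_law.

(** * Standardized prices as a triangular image of the shocks *)

Section price_model.
Context d (Omega : measurableType d) (R : realType) (P : probability Omega R).
Variables (dt K theta sigma : R) (eps : nat -> {RV P >-> R}) (n : nat) (x : R).
Hypothesis dt_gt0 : 0 < dt.
Hypothesis sigma_gt0 : 0 < sigma.
Hypothesis K_lt1 : `|1 - K * dt| < 1.

Let a := 1 - dt * K.
Local Notation sd := (price_sd dt K sigma).
Local Notation Z := (std_price dt K theta sigma eps).

Lemma AR1_coef_sqr_lt1 : a ^+ 2 < 1.
Proof.
rewrite -(ger0_norm (sqr_ge0 a)) normrX expr_lt1// /a mulrC.
exact: K_lt1.
Qed.

(** A geometric sum, of ratio less than 1; in this form the variance is visibly positive. *)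
Lemma price_sd_sqr l :
  dt * sigma ^+ 2 * ((1 - a ^+ (2 * l)) / (1 - a ^+ 2))
  = dt * sigma ^+ 2 * \sum_(j < l) (a ^+ 2) ^+ j.
Proof.
congr (_ * _); rewrite exprM; apply: (canLR (mulfK _)).
  by rewrite gt_eqF// subr_gt0 AR1_coef_sqr_lt1.
by rewrite mulrC -[LHS]opprB subrX1 -mulNr opprB.
Qed.

Lemma price_sdE l : sd n (idx n l) = Num.sqrt (dt * sigma ^+ 2 * \sum_(j < l.+1) (a ^+ 2) ^+ j).
Proof.
rewrite /price_sd -/a /idx addSn -addnS addKn.
by rewrite price_sd_sqr.
Qed.

Lemma price_var_gt0 l : 0 < dt * sigma ^+ 2 * \sum_(j < l.+1) (a ^+ 2) ^+ j.
Proof.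
rewrite !mulr_gt0 ?exprn_gt0// big_ord_recl expr0 ltr_pwDl// sumr_ge0// => j _.
by rewrite exprn_ge0// sqr_ge0.
Qed.

Lemma price_sd_gt0 l : 0 < sd n (idx n l).
Proof. by rewrite price_sdE sqrtr_gt0 price_var_gt0. Qed.

(** Entry [(r, l)] is the weight of the shock of time [n.+1 + r] in the standardized price of time
    [idx n l]. Shocks later than the price have weight 0, and [Num.sqrt dt] compensates the scaling
    of the shocks to unit variance. *)
Definition shock_mx k : 'M[R]_k :=
  \matrix_(r, l) if (r <= l)%N then sigma * Num.sqrt dt * a ^+ (l - r) / sd n (idx n l) else 0.

Lemma shock_mx_triangular k (r l : 'I_k) : (l < r)%N -> shock_mx k r l = 0.
Proof. by move=> lr; rewrite mxE leqNgt lr. Qed.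

Lemma shock_mx_diag k (l : 'I_k) : shock_mx k l l != 0.
Proof.
rewrite mxE leqnn subnn expr0 mulr1 mulf_neq0 ?invr_neq0 ?mulf_neq0//.
- by rewrite gt_eqF.
- by rewrite gt_eqF ?sqrtr_gt0.
- by rewrite gt_eqF ?price_sd_gt0.
Qed.

(** The matrix indexes shocks by time [r], the price formula by age [l - r]; the sum is reversed. *)
Lemma sum_shock_col k (l : 'I_k) (F : nat -> R) :
  \sum_(r < k) (if (r <= l)%N then F (l - r)%N else 0) = \sum_(j < l.+1) F j.
Proof.
rewrite -big_mkcond/= -(big_ord_widen _ (fun r => F (l - r)%N) (ltn_ord l)).
rewrite (reindex_inj rev_ord_inj)/=; apply: eq_bigr => j _.
by rewrite subSS subKn// -ltnS.
Qed.

Lemma shock_mx_gram_diag k (l : 'I_k) : ((shock_mx k)^T *m shock_mx k) l l = 1.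
Proof.
pose F j := sigma ^+ 2 * dt * (a ^+ 2) ^+ j / sd n (idx n l) ^+ 2.
rewrite mxE; transitivity (\sum_(r < k) (if (r <= l)%N then F (l - r)%N else 0)).
  apply: eq_bigr => r _; rewrite !mxE; case: ifP => _; last by rewrite mul0r.
  rewrite /F -[X in _ = _ * X * _ / _](sqr_sqrtr (ltW dt_gt0)) -exprM mulnC exprM.
  by field; rewrite gt_eqF ?price_sd_gt0.
rewrite sum_shock_col /F -big_distrl/= -big_distrr/= price_sdE sqr_sqrtr ?(ltW (price_var_gt0 _))//.
by rewrite (mulrC (sigma ^+ 2)) divff// gt_eqF// price_var_gt0.
Qed.

Lemma std_price_shock k (l : 'I_k) w :
  Z n (idx n l) x w
  = ((\row_(r < k) (eps (n.+1 + r)%N w / Num.sqrt dt)) *m shock_mx k) ord0 l.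
Proof.
have sdt : Num.sqrt dt != 0 by rewrite gt_eqF ?sqrtr_gt0.
rewrite /std_price /Defs.price /price_mean addrAC subrr add0r -/a.
rewrite (_ : (idx n l - n)%N = l.+1); last by rewrite /idx addSn -addnS addKn.
pose F j := sigma * a ^+ j * eps (idx n l - j)%N w / sd n (idx n l).
transitivity (\sum_(j < l.+1) F j).
  by rewrite -[RHS]big_distrl/= big_distrr/=; congr (_ / _); apply: eq_bigr => j _; rewrite mulrA.
rewrite mxE -(sum_shock_col l F); apply: eq_bigr => r _; rewrite !mxE.
case: ifP => rl; last by rewrite mulr0.
rewrite /F (_ : (idx n l - (l - r))%N = (n.+1 + r)%N); last first.
  by rewrite /idx -addnBA ?leq_subr// subKn.
by field; rewrite sdt gt_eqF ?price_sd_gt0.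
Qed.

End price_model.

Section crossing.
Context d (Omega : measurableType d) (R : realType) (P : probability Omega R).
Variables (dt K theta sigma : R) (eps : nat -> {RV P >-> R}) (N : nat).
Variables (b : nat -> \bar R) (n : nat) (x : R).
Hypothesis dt_gt0 : 0 < dt.
Local Notation price := (price dt K theta sigma eps).

Lemma ler_grid_time j m : (grid_time dt j <= grid_time dt m) = (j <= m)%N.
Proof. by rewrite /grid_time ler_pM2r// ler_nat. Qed.

Lemma crossing_time_min m w : (n < m <= N)%N -> ((price n m x w)%:E <= b m)%E ->
  (forall j, (n < j <= N)%N -> ((price n j x w)%:E <= b j)%E -> (m <= j)%N) ->
  crossing_time dt K theta sigma eps N b n x w = (grid_time dt m)%:E.
Proof.
move=> nmN mb minm; apply/eqP; rewrite eq_le; apply/andP; split.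
  by apply: ereal_inf_lbound; exists m.
apply: le_ereal_inf_tmp => _ [j [njN jb] <-].
by rewrite lee_fin ler_grid_time; exact: minm.
Qed.

(** Grid times increase strictly, so the infimum is attained at the least crossing index and
    determines it; without any crossing it is [+oo], which is no grid time. *)
Lemma crossing_timeE i w : (n < i <= N)%N ->
  crossing_time dt K theta sigma eps N b n x w = (grid_time dt i)%:E <->
  ((price n i x w)%:E <= b i)%E /\
  (forall j, (n < j < i)%N -> (b j < (price n j x w)%:E)%E).
Proof.
move=> niN; split; last first.
  move=> [ib before]; apply: crossing_time_min => // j /andP[nj _] jb.
  rewrite leqNgt; apply/negP => ji; have := before j.
  by rewrite nj ji ltNge jb => /(_ isT).
pose C j := (n < j <= N)%N && ((price n j x w)%:E <= b j)%E.
move=> ti; have [[j Cj]|noC] := pselect (exists j, C j); last first.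
  exfalso; move: ti; rewrite /crossing_time; set T := (X in ereal_inf X).
  suff -> : T = set0 by rewrite ereal_inf0.
  apply/seteqP; split => // y [j [njN jb] _]; apply: noC; exists j.
  by rewrite /C njN jb.
have [m /andP[nmN mb] minm] := ex_minnP (ex_intro C j Cj).
have minm' k : (n < k <= N)%N -> ((price n k x w)%:E <= b k)%E -> (m <= k)%N.
  by move=> nkN kb; apply: minm; rewrite /C nkN kb.
have im : i = m.
  have := crossing_time_min nmN mb minm'; rewrite ti => -[] /eqP.
  by rewrite eq_le !ler_grid_time -eqn_leq => /eqP.
rewrite im; split=> // k /andP[nk km]; rewrite ltNge; apply/negP => kb.
have /andP[_ mN] := nmN.
by have := minm' k; rewrite nk (ltnW (leq_trans km mN)) leqNgt km => /(_ isT kb).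
Qed.

End crossing.

Section overshoot_algebra.
Context {R : realType}.

Lemma lt_standardize (B : \bar R) (m s p : R) : 0 < s ->
  ((B - m%:E) * (s^-1)%:E < ((p - m) / s)%:E)%E = (B < p%:E)%E.
Proof.
move=> s0; case: B => [r| |].
- by rewrite !lte_fin ltr_pM2r ?invr_gt0// ltrD2r.
- by rewrite [X in (X * _)%E]addye// gt0_mulye ?lte_fin ?invr_gt0.
- by rewrite addNye gt0_mulNye ?lte_fin ?invr_gt0// !ltNyr.
Qed.

(* If [qh = 0] or [q = qh], both sides are 0 because division by 0 is 0. *)
Lemma overshoot_ratio (m s q qh u uh : R) (last : bool) :
  0 <= q -> q <= qh -> (q = 0 -> u = 0) -> (last -> q = 0) ->
  (m * qh + s * uh - (m * q + s * u)) / (qh - q)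
  = (m + s * uh / qh - (if last then 0 else (1 - (qh - q) / qh) * (m + s * u / q)))
    / ((qh - q) / qh).
Proof.
move=> q0 qqh qu lq; have [qh0|qh0] := eqVneq qh 0.
  have -> : q = 0 by apply/eqP; rewrite eq_le q0 -qh0 qqh.
  by rewrite qh0 subrr mul0r invr0 !mulr0.
have [qE|qN] := eqVneq q 0.
  rewrite qE (qu qE) subr0 divff// subrr mul0r (_ : (if last then 0 else 0) = 0); last by case: last {lq}.
  by rewrite subr0 divr1 !mulr0 addr0 subr0; field.
have -> : last = false by apply/negP => /lq/eqP; rewrite (negbTE qN).
have [->|qqhN] := eqVneq q qh; first by rewrite subrr mul0r invr0 !mulr0.
by field; rewrite qN qh0 subr_eq0 eq_sym qqhN.
Qed.

End overshoot_algebra.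

Theorem mainTheorem4
  (d : measure_display) (Omega : measurableType d) (R : realType)
  (P : probability Omega R)
  (T dt K theta sigma : R) (N : nat)
  (eps : nat -> {RV P >-> R}) (h : nat -> R) (b : nat -> \bar R)
  (dt_gt0 : 0 < dt) (NE : N%:R = T / dt)
  (sigma_gt0 : 0 < sigma) (K_lt1 : `|1 - K * dt| < 1)
  (eps_indep : mutually_independent (fun j => (1 <= j <= N)%N) eps)
  (eps_normal : forall j, (1 <= j <= N)%N -> forall A : set R, measurable A ->
     distribution P (eps j) A = normal_prob 0 (Num.sqrt dt) A)
  (h_decr : forall i j, (i <= j < N)%N -> h j <= h i)
  (b_threshold : is_threshold dt K theta sigma eps N h b) :
  forall (n i : nat) (x : R), (n < i <= N)%N ->
    let p := stop_prob dt K theta sigma eps b n i x in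
    let e := trunc_mean dt K theta sigma eps b n i x in
    let e_hat := trunc_mean_hat dt K theta sigma eps b n i x in
    overshoot dt K theta sigma eps N b n i x
    = (e_hat - (if i == N then 0 else (1 - p) * e)) / p.
Proof.
move=> n i x niN p e e_hat.
have [ni iN] := andP niN.
pose k := (i - n)%N.
have k_gt0 : (0 < k)%N by rewrite subn_gt0.
have idx_in (r : 'I_k) : (1 <= n.+1 + r <= N)%N.
  rewrite addSn ltn0Sn/= -addnS; apply: leq_trans iN.
  by rewrite -(subnKC (ltnW ni)) leq_add2l ltn_ord.
have idx_le (r : 'I_k) : (idx n r <= i)%N.
  by rewrite /idx addSn -addnS -[leqRHS](subnKC (ltnW ni)) leq_add2l ltn_ord.
(* Position 0 stands for time [n.+1], so time [i] sits at position [k.-1]. *)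
have last_lt : (k.-1 < k)%N by rewrite prednK.
pose last : 'I_k := Ordinal last_lt.
have idx_last : idx n last = i.
  by rewrite /idx/= addSn -addnS prednK// subnKC// ltnW.
pose mean := price_mean dt K theta n i x.
pose sd := price_sd dt K sigma n i.
pose Z j := std_price dt K theta sigma eps n j x.
pose c := std_cov dt K theta sigma eps n x.
pose X (r : 'I_k) w := eps (n.+1 + r)%N w / Num.sqrt dt.
pose U := shock_mx dt K sigma n k.
pose Zrow w : 'rV[R]_k := (\row_r X r w) *m U.
have mX r : measurable_fun setT (X r) by exact: measurable_funM.
have lawX (A : 'I_k -> set R) : (forall r, measurable (A r)) ->
    P (\bigcap_(r in [set: 'I_k]) (X r @^-1` A r)) = (\prod_(r < k) normal_prob 0 1 (A r))%E.
  have s0 : 0 < Num.sqrt dt by rewrite sqrtr_gt0.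
  exact: (shock_vector_law s0 eps_indep eps_normal idx_in).
have tU (r l : 'I_k) : (l < r)%N -> U r l = 0 by exact: shock_mx_triangular.
have dU l : U l l != 0 by exact: shock_mx_diag.
have ZrowE l w : Zrow w ord0 l = Z (idx n l) w.
  by rewrite /Z (std_price_shock theta eps n x dt_gt0 sigma_gt0 K_lt1 l w).
pose S := U^T *m U.
(* Covariances are expectations in the statement; here they become Gram entries of the shock
   weights. *)
have SE l m : S l m = c (idx n l) (idx n m).
  rewrite /c /std_cov.
  rewrite (_ : std_price _ _ _ _ _ _ (idx n l) x = fun w => Zrow w ord0 l); last first.
    by apply/funext => w; rewrite ZrowE.
  rewrite (_ : std_price _ _ _ _ _ _ (idx n m) x = fun w => Zrow w ord0 m); last first.
    by apply/funext => w; rewrite ZrowE.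
  by rewrite (covariance_gaussian mX lawX tU dU).
have S1 l : S l l = 1 by exact: shock_mx_gram_diag.
have covE : cov_mx dt K theta sigma eps n i x = S.
  by apply/matrixP => l m; rewrite SE mxE.
pose B := B_vec dt K theta sigma b n i x.
pose Bh := B_hat_vec dt K theta sigma b n i x.
pose q := mvn_cdf (opp_vec B) S.
pose qh := mvn_cdf (opp_vec Bh) S.
pose G := [set w | row_gt B (Zrow w)].
pose Gh := [set w | row_gt Bh (Zrow w)].
pose M l : 'M[R]_k.-1 := partial_corr_mx dt K theta sigma eps x l.
have ME l j m : M l j m = (S (lift l j) (lift l m) - S (lift l j) l * S (lift l m) l)
    / (Num.sqrt (1 - S (lift l j) l ^+ 2) * Num.sqrt (1 - S (lift l m) l ^+ 2)).
  by rewrite [LHS]mxE !SE.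
pose A l : 'rV[\bar R]_k.-1 := A_vec dt K theta sigma eps b x l.
pose Ah l : 'rV[\bar R]_k.-1 := A_hat_vec dt K theta sigma eps b x l.
have AE l j : B ord0 l \is a fin_num ->
    A l ord0 j = ((B ord0 (lift l j) - (S (lift l j) l)%:E * B ord0 l)
    * ((Num.sqrt (1 - S (lift l j) l ^+ 2))^-1)%:E)%E.
  by move=> _; rewrite [LHS]mxE SE /alpha ![B ord0 _]mxE.
have Sj_lt1 l j : 0 < 1 - S (lift l j) l ^+ 2.
  by apply: gram_corr_lt1; rewrite ?neq_lift//; exact: triangular_unitmx.
(* If [l] is the last position, its bound [-oo] is not finite and nothing is asked. If [lift l j] is
   last, [-oo] survives subtraction of a finite number and division by a positive one, as in
   [alpha_hat]. *)
have AhE l j : Bh ord0 l \is a fin_num ->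
    Ah l ord0 j = ((Bh ord0 (lift l j) - (S (lift l j) l)%:E * Bh ord0 l)
    * ((Num.sqrt (1 - S (lift l j) l ^+ 2))^-1)%:E)%E.
  have := Sj_lt1 l j; rewrite [Ah l ord0 j]mxE SE ![Bh ord0 _]mxE /alpha_hat /beta_hat => S0.
  case: (ltnP (idx n l) i) => // li bl; case: ifP => // _.
  by rewrite -(fineK bl) -EFinM addNye gt0_mulNye// lte_fin invr_gt0 sqrtr_gt0.
pose u := \sum_l S last l * std_normal_pdf (B ord0 l) * mvn_cdf (opp_vec (A l)) (M l).
pose uh := \sum_l S last l * std_normal_pdf (Bh ord0 l) * mvn_cdf (opp_vec (Ah l)) (M l).
have PG : P G = q%:E by exact: (probability_orthant mX lawX tU dU).
have PGh : P Gh = qh%:E by exact: (probability_orthant mX lawX tU dU).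
have IG : (\int[P]_(w in G) (Zrow w ord0 last)%:E = u%:E)%E.
  exact: (integral_orthant_gaussian mX lawX tU dU last S1 AE ME).
have IGh : (\int[P]_(w in Gh) (Zrow w ord0 last)%:E = uh%:E)%E.
  exact: (integral_orthant_gaussian mX lawX tU dU last S1 AhE ME).
have mrow C : measurable [set w | row_gt C (Zrow w)].
  rewrite -[X in measurable X]setTI.
  exact: (measurableT_comp (measurable_row_gt C) (measurable_gaussian_vector U mX))
    measurableT [set true] _.
have sd0 l : 0 < price_sd dt K sigma n (idx n l) by exact: price_sd_gt0.
have sdi : 0 < sd by rewrite /sd -idx_last.
have betaE l w : (beta dt K theta sigma b n x (idx n l) < (Z (idx n l) w)%:E)%E
    = (b (idx n l) < (price dt K theta sigma eps n (idx n l) x w)%:E)%E.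
  exact: lt_standardize.
have GGh : G `<=` Gh.
  move=> w /forallP Gw; apply/forallP => l; have := Gw l; rewrite ![_ ord0 l]mxE.
  by rewrite /beta_hat; case: ifP => // _ _; rewrite ltNyr.
have eventE : [set w | crossing_time dt K theta sigma eps N b n x w = (grid_time dt i)%:E]
    = Gh `\` G.
  apply/seteqP; split => w.
  - move=> /(crossing_timeE _ _ _ _ _ _ dt_gt0 _ niN)[ib before]; split.
    + apply/forallP => l; rewrite ZrowE [Bh _ _]mxE /beta_hat.
      case: ltnP => li; last by rewrite ltNyr.
      by rewrite betaE before// /idx addSn ltnS leq_addr.
    + move=> /forallP/(_ last); rewrite ZrowE [B _ _]mxE betaE idx_last.
      by rewrite ltNge ib.
  - move=> [/forallP Ghw nGw]; apply/(crossing_timeE _ _ _ _ _ _ dt_gt0 _ niN).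
    have before (l : 'I_k) : (idx n l < i)%N ->
        (b (idx n l) < (price dt K theta sigma eps n (idx n l) x w)%:E)%E.
      by move=> li; have := Ghw l; rewrite ZrowE [Bh _ _]mxE /beta_hat li betaE.
    split.
    + rewrite leNgt; apply/negP => ib; apply: nGw; apply/forallP => l.
      rewrite ZrowE [B _ _]mxE betaE; have [li|il] := ltnP (idx n l) i; first exact: before.
      by have -> : idx n l = i by apply/eqP; rewrite eqn_leq il idx_le.
    + move=> j /andP[nj ji].
      have jk : (j - n.+1 < k)%N by apply: leq_ltn_trans (leq_sub2l j (leqnSn n)) _; exact: ltn_sub2r.
      by have := before (Ordinal jk); rewrite /idx/= subnKC//; exact.
have priceE w : price dt K theta sigma eps n i x w = mean + sd * Zrow w ord0 last.
  by rewrite ZrowE idx_last /Z /std_price mulrC divfK ?gt_eqF// addrC subrK.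
have Zi : P.-integrable setT (fun w => (Zrow w ord0 last)%:E).
  exact: (integrable_gaussian_coord mX lawX tU dU).
have Xi : P.-integrable setT (fun w => (price dt K theta sigma eps n i x w)%:E).
  under eq_fun do rewrite priceE EFinD EFinM.
  apply: integrableD => //; last exact: integrableZl.
  exact: finite_measure_integrable_cst.
have IX D v r : measurable D -> P D = v%:E -> (\int[P]_(w in D) (Zrow w ord0 last)%:E = r%:E)%E ->
    (\int[P]_(w in D) (price dt K theta sigma eps n i x w)%:E = (mean * v + sd * r)%:E)%E.
  move=> mD PD ID.
  have ZiD := integrableS measurableT mD (@subsetT _ D) Zi.
  under eq_integral do rewrite priceE EFinD EFinM.
  rewrite integralD//; last 2 first.
  - exact: finite_measure_integrable_cst.
  - exact: integrableZl.
  rewrite integral_cst// integralZl// ID.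
  by transitivity (mean%:E * v%:E + sd%:E * r%:E)%E; rewrite // -PD.
have mG : measurable G by exact: mrow.
have mGh : measurable Gh by exact: mrow.
have PE : P (Gh `\` G) = (qh - q)%:E.
  apply: etrans (measureD mGh mG _) _; last first.
    by rewrite setIidr// EFinB -PGh -PG.
  by have := ltry qh; rewrite -PGh.
have IE : (\int[P]_(w in Gh `\` G) (price dt K theta sigma eps n i x w)%:E
    = (mean * qh + sd * uh - (mean * q + sd * u))%:E)%E.
  (* The integral over the difference is not known to be finite beforehand; a finite sum with a
     finite term forces it. *)
  have subE (y z : R) (I : \bar R) : (y%:E + I = z%:E -> I = (z - y)%:E)%E.
    by case: I => [r []<-|//|//]; rewrite addrAC subrr add0r.
  apply: subE; rewrite -(IX _ _ _ mG PG IG) -(IX _ _ _ mGh PGh IGh).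
  rewrite -[in RHS](setDUK GGh) integral_setU//.
  - exact: measurableD.
  - exact: measurable_funTS (measurable_int _ Xi).
  - by rewrite disj_set2E setDIK.
have q0 : 0 <= q by rewrite -lee_fin -PG measure_ge0.
have qqh : q <= qh by rewrite -lee_fin -PG -PGh le_measure ?inE.
(* An integral over a null event vanishes; this covers a zero denominator in [trunc_mean]. *)
have qu : q = 0 -> u = 0.
  move=> qE; apply: EFin_inj; rewrite -IG null_set_integral//.
  - exact: measurable_funTS (measurable_int _ Zi).
  - by apply: etrans PG _; rewrite qE.
(* At the horizon the threshold is [+oo], so no price exceeds it and [G] is empty. *)
have lq : i == N -> q = 0.
  move=> /eqP iNE; apply: EFin_inj; rewrite -PG (_ : G = set0) ?measure0//.
  apply/seteqP; split => // w /forallP/(_ last).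
  by rewrite ZrowE [B _ _]mxE betaE idx_last iNE; case: b_threshold => _ ->.
rewrite /overshoot eventE /cond_expectation PE IE /=.
rewrite (overshoot_ratio mean sd uh q0 qqh qu lq).
rewrite /p /e /e_hat /stop_prob /trunc_mean /trunc_mean_hat covE -/B -/Bh -/q -/qh -/mean -/sd.
have -> : u = \sum_(l < i - n) std_cov dt K theta sigma eps n x i (idx n l)
    * std_normal_pdf (beta dt K theta sigma b n x (idx n l)) * mvn_cdf (opp_vec (A l)) (M l).
  by apply: eq_bigr => l _; rewrite SE idx_last [B _ _]mxE.
have -> : uh = \sum_(l < i - n) std_cov dt K theta sigma eps n x i (idx n l)
    * std_normal_pdf (beta_hat dt K theta sigma b n i x (idx n l)) * mvn_cdf (opp_vec (Ah l)) (M l).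
  by apply: eq_bigr => l _; rewrite SE idx_last [Bh _ _]mxE.
by [].
Qed.
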